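(* Let $k$ be a field and $n\ge1$. The center of $\Lambda^1(\widetilde{A_n})$ is isomorphic to $k[X,Y,Z]/(Z^{n+1}+XY+XYZ)$.
   Context: $\widetilde{A_n}$ is the quiver which is a cycle with $n+1$ vertices and $n+1$ arrows. For a finite quiver $Q$, let $\overline{Q}$ be its double (reverse arrow $a^*$ added for each $a\in Q_1$, $(a^* )^*=a$), $\epsilon(a)=1$ for $a\in Q_1$, $-1$ otherwise; $L_Q=k\overline{Q}[(1+aa^* )^{-1}]_{a\in\overline{Q}_1}$ is the localized path algebra; for a fixed total order on $\overline{Q}_1$, $\rho=\prod_{a\in\overline{Q}_1}(1+aa^* )^{\epsilon(a)}$. Then $\Lambda^1(Q)=L_Q/(\rho-1)$ is the multiplicative preprojective algebra with parameter $q=(1,\dots,1)$. Its isomorphism class is independent of orientation and ordering. *)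

(* Defs.v *)
From HB Require Import structures.
From mathcomp Require Import all_boot all_algebra.
From mathcomp.classical Require Import boolp.
From mathcomp Require Import finmap.
From mathcomp.multinomials Require Import mpoly monalg.

Set Implicit Arguments.
Unset Strict Implicit.
Unset Printing Implicit Defensive.

Import GRing.Theory.
Local Open Scope ring_scope.

(* The library's [algType] requires 1 != 0, which quotients and localizations
   need not satisfy.  A [pzAlgType k] is a ring, possibly zero, with a ring
   morphism from k to its center. *)
HB.mixin Record PzRing_hasScalar (k : comNzRingType) (A : Type)
    of GRing.PzRing A := {
  scalar : {rmorphism k -> A};
  scalar_central : forall (c : k) (x : A), scalar c * x = x * scalar c
}.

#[short(type="pzAlgType")]
HB.structure Definition PzAlgebra (k : comNzRingType) :=
  { A of PzRing_hasScalar k A & GRing.PzRing A }.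

Arguments scalar {k A} : rename.

Definition alg_isomorphic (k : comNzRingType) (A B : pzAlgType k) : Prop :=
  exists f : {rmorphism A -> B},
    bijective f /\ forall c : k, f (scalar c) = scalar c.

Lemma in_alg_central (k : comNzRingType) (A : algType k) (c : k) (x : A) :
  in_alg A c * x = x * in_alg A c.
Proof. by rewrite !in_algE mulr_algl mulr_algr. Qed.

HB.instance Definition _ (k : comNzRingType) (n : nat) :=
  PzRing_hasScalar.Build k (mpoly n k) (@in_alg_central k (mpoly n k)).

Section Center.
Variables (k : comNzRingType) (A : pzAlgType k).

Definition in_center : pred A := fun x => `[< forall y, x * y = y * x >].

Lemma centerP (x : A) : reflect (forall y, x * y = y * x) (in_center x).
Proof. exact: asboolP. Qed.

Fact center_subring_closed : subring_closed in_center.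
Proof.
split=> [|x y /centerP cx /centerP cy|x y /centerP cx /centerP cy];
  apply/centerP => z; rewrite ?mul1r ?mulr1 //.
- by rewrite mulrBl mulrBr cx cy.
- by rewrite -mulrA cy mulrA cx mulrA.
Qed.
HB.instance Definition _ :=
  GRing.isSubringClosed.Build A in_center center_subring_closed.

Definition center_alg := {x : A | in_center x}.
HB.instance Definition _ := SubChoice.on center_alg.
HB.instance Definition _ :=
  GRing.SubChoice_isSubPzRing.Build A in_center center_alg center_subring_closed.

Fact center_scalar (c : k) : in_center (scalar c).
Proof. by apply/centerP => x; rewrite scalar_central. Qed.

Definition cscalar (c : k) : center_alg := Sub (scalar c) (center_scalar c).
Fact cscalar_zmod : zmod_morphism cscalar.
Proof. by move=> c d; apply: val_inj; rewrite /= !raddfB. Qed.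
Fact cscalar_monoid : monoid_morphism cscalar.
Proof. by split=> [|c d]; apply: val_inj; rewrite /= ?rmorph1 ?rmorphM. Qed.
HB.instance Definition _ :=
  GRing.isZmodMorphism.Build k center_alg cscalar cscalar_zmod.
HB.instance Definition _ :=
  GRing.isMonoidMorphism.Build k center_alg cscalar cscalar_monoid.
Fact cscalar_central (c : k) (x : center_alg) : cscalar c * x = x * cscalar c.
Proof. by apply: val_inj; rewrite !rmorphM /= scalar_central. Qed.
HB.instance Definition _ :=
  PzRing_hasScalar.Build k center_alg cscalar_central.

End Center.

Section Quotient.
Variables (k : comNzRingType) (A : pzAlgType k) (rel : A -> Prop).
Implicit Types x y z : A.

Inductive ideal_spec : A -> Prop :=
| Ideal0 : ideal_spec 0
| IdealD x y : ideal_spec x -> ideal_spec y -> ideal_spec (x + y)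
| IdealM x r y : rel r -> ideal_spec (x * r * y).

Lemma idealMl z x : ideal_spec x -> ideal_spec (z * x).
Proof.
elim=> [|u v _ iu _ iv|u r v rr].
- by rewrite mulr0; apply: Ideal0.
- by rewrite mulrDr; apply: IdealD.
- by rewrite !mulrA; apply: IdealM.
Qed.

Lemma idealMr z x : ideal_spec x -> ideal_spec (x * z).
Proof.
elim=> [|u v _ iu _ iv|u r v rr].
- by rewrite mul0r; apply: Ideal0.
- by rewrite mulrDl; apply: IdealD.
- by rewrite -mulrA; apply: IdealM.
Qed.

Definition gen_ideal_pred : pred A := fun x => `[< ideal_spec x >].

Fact gen_ideal_zmod_closed : zmod_closed gen_ideal_pred.
Proof.
split=> [|x y /asboolP xI /asboolP yI]; apply/asboolP; first exact: Ideal0.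
by apply: IdealD => //; rewrite -mulN1r; apply: idealMl.
Qed.
HB.instance Definition _ :=
  GRing.isZmodClosed.Build A gen_ideal_pred gen_ideal_zmod_closed.
Definition gen_ideal : zmodClosed A := GRing.ZmodClosed.clone A gen_ideal_pred _.

Definition alg_quot := {ideal_quot gen_ideal}.
HB.instance Definition _ := GRing.Zmodule.on alg_quot.

Definition qproj (x : A) : alg_quot := \pi_{ideal_quot gen_ideal}%qT x.

Lemma qproj_surj (u : alg_quot) : exists x, u = qproj x.
Proof. by exists (repr u); rewrite /qproj reprK. Qed.

Lemma qproj_eq x y : (qproj x = qproj y) <-> ideal_spec (x - y).
Proof.
rewrite /qproj; split=> [/eqP|xy].
  by rewrite -Quotient.idealrBE => /asboolP.
by apply/eqP; rewrite -Quotient.idealrBE; apply/asboolP.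
Qed.

Fact qproj_zmod : zmod_morphism qproj.
Proof. by move=> x y; rewrite /qproj raddfB. Qed.
HB.instance Definition _ :=
  GRing.isZmodMorphism.Build A alg_quot qproj qproj_zmod.

Lemma qproj_repr (u : alg_quot) : qproj (repr u) = u.
Proof. exact: reprK. Qed.

Definition qmul (u v : alg_quot) : alg_quot := qproj (repr u * repr v).

Lemma qprojM_subproof x y : qmul (qproj x) (qproj y) = qproj (x * y).
Proof.
set x' := repr (qproj x); set y' := repr (qproj y).
have /qproj_eq xI : qproj x' = qproj x by apply: qproj_repr.
have /qproj_eq yI : qproj y' = qproj y by apply: qproj_repr.
apply/qproj_eq; rewrite -/x' -/y'.
have -> : x' * y' - x * y = x' * (y' - y) + (x' - x) * y.
  by rewrite mulrBr mulrBl addrA subrK.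
by apply: IdealD; [apply: idealMl | apply: idealMr].
Qed.

Fact qmulA : associative qmul.
Proof.
move=> u v w; case: (qproj_surj u) (qproj_surj v) (qproj_surj w) => x -> [y ->] [z ->].
by rewrite !qprojM_subproof mulrA.
Qed.
Fact qmul1 : left_id (qproj 1) qmul.
Proof. by move=> u; case: (qproj_surj u) => x ->; rewrite qprojM_subproof mul1r. Qed.
Fact qmulr1 : right_id (qproj 1) qmul.
Proof. by move=> u; case: (qproj_surj u) => x ->; rewrite qprojM_subproof mulr1. Qed.
Fact qmulDl : left_distributive qmul +%R.
Proof.
move=> u v w; case: (qproj_surj u) (qproj_surj v) (qproj_surj w) => x -> [y ->] [z ->].
by rewrite -raddfD !qprojM_subproof mulrDl raddfD.
Qed.
Fact qmulDr : right_distributive qmul +%R.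
Proof.
move=> u v w; case: (qproj_surj u) (qproj_surj v) (qproj_surj w) => x -> [y ->] [z ->].
by rewrite -raddfD !qprojM_subproof mulrDr raddfD.
Qed.
HB.instance Definition _ := GRing.Zmodule_isPzRing.Build alg_quot
  qmulA qmul1 qmulr1 qmulDl qmulDr.

Fact qproj_monoid : monoid_morphism qproj.
Proof. by split=> // x y; rewrite -qprojM_subproof. Qed.
HB.instance Definition _ :=
  GRing.isMonoidMorphism.Build A alg_quot qproj qproj_monoid.

Definition qscalar (c : k) : alg_quot := qproj (scalar c).
HB.instance Definition _ :=
  GRing.RMorphism.copy qscalar (qproj \o @scalar k A).
Fact qscalar_central (c : k) (u : alg_quot) : qscalar c * u = u * qscalar c.
Proof.
case: (qproj_surj u) => x ->.
by rewrite /qscalar -!rmorphM /= scalar_central.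
Qed.
HB.instance Definition _ := PzRing_hasScalar.Build k alg_quot qscalar_central.

End Quotient.

Section FreeAlgebra.
Variables (k : comNzRingType) (X : choiceType).

Definition free_alg := {malg k[{fmonom X}]}.
HB.instance Definition _ := GRing.NzRing.on free_alg.

Definition fvar (x : X) : free_alg := << (1 : k) *g fmu x >>.

Definition fscalar (c : k) : free_alg := << c *g (mone : {fmonom X}) >>.
Fact fscalar_zmod : zmod_morphism fscalar.
Proof. by move=> c d; rewrite /fscalar raddfB. Qed.
Fact fscalar_monoid : monoid_morphism fscalar.
Proof. by split=> [|c d]; rewrite /fscalar ?rmorph1 ?rmorphM. Qed.
HB.instance Definition _ :=
  GRing.isZmodMorphism.Build k free_alg fscalar fscalar_zmod.
HB.instance Definition _ :=
  GRing.isMonoidMorphism.Build k free_alg fscalar fscalar_monoid.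
Fact fscalar_central (c : k) (x : free_alg) : fscalar c * x = x * fscalar c.
Proof.
rewrite [LHS]fgmulUg [RHS]fgmulgU; apply: eq_bigr => m _.
by rewrite mul1m mulm1 mulrC.
Qed.
HB.instance Definition _ := PzRing_hasScalar.Build k free_alg fscalar_central.

End FreeAlgebra.

(* [loc_alg s] is A[s i ^-1, i : I], presented by one generator for each
   element of A and a formal inverse for each index. *)
Section Localization.
Variables (k : comNzRingType) (A : pzAlgType k) (I : choiceType) (s : I -> A).

Let base (x : A) : free_alg k (A + I)%type := fvar k (inl x).
Let finv (i : I) : free_alg k (A + I)%type := fvar k (inr i).

Inductive loc_rel : free_alg k (A + I)%type -> Prop :=
| LocAdd x y : loc_rel (base (x + y) - (base x + base y))
| LocMul x y : loc_rel (base (x * y) - base x * base y)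
| LocScalar c : loc_rel (base (scalar c) - scalar c)
| LocInvr i : loc_rel (base (s i) * finv i - 1)
| LocInvl i : loc_rel (finv i * base (s i) - 1).

Definition loc_alg := alg_quot loc_rel.
HB.instance Definition _ := PzAlgebra.on loc_alg.

Definition loc_in (x : A) : loc_alg := qproj loc_rel (base x).
Definition loc_inv (i : I) : loc_alg := qproj loc_rel (finv i).

Lemma qproj_rel x y : loc_rel (x - y) -> qproj loc_rel x = qproj loc_rel y.
Proof.
move=> rxy; apply/qproj_eq; rewrite -[_ - _]mulr1 -[_ - _]mul1r.
exact: IdealM.
Qed.

Lemma loc_inD : {morph loc_in : x y / x + y}.
Proof. by move=> x y; rewrite -rmorphD; apply/qproj_rel/LocAdd. Qed.
Lemma loc_inM : {morph loc_in : x y / x * y}.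
Proof. by move=> x y; rewrite -rmorphM; apply/qproj_rel/LocMul. Qed.
Lemma loc_in_scalar (c : k) : loc_in (scalar c) = scalar c.
Proof. exact/qproj_rel/LocScalar. Qed.

Fact loc_in_zmod : zmod_morphism loc_in.
Proof.
by move=> x y; apply: (addIr (loc_in y)); rewrite -loc_inD !subrK.
Qed.
Fact loc_in_monoid : monoid_morphism loc_in.
Proof.
by split; [rewrite -(rmorph1 (@scalar k A)) loc_in_scalar rmorph1 | exact: loc_inM].
Qed.
HB.instance Definition _ :=
  GRing.isZmodMorphism.Build A loc_alg loc_in loc_in_zmod.
HB.instance Definition _ :=
  GRing.isMonoidMorphism.Build A loc_alg loc_in loc_in_monoid.

Lemma loc_mulrV i : loc_in (s i) * loc_inv i = 1.
Proof. by rewrite /loc_in /loc_inv -[LHS](rmorphM (qproj loc_rel)); apply/qproj_rel/LocInvr. Qed.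
Lemma loc_mulVr i : loc_inv i * loc_in (s i) = 1.
Proof. by rewrite /loc_in /loc_inv -[LHS](rmorphM (qproj loc_rel)); apply/qproj_rel/LocInvl. Qed.

End Localization.

Record quiver := Quiver {
  vertex : finType;
  arrow : finType;
  source : arrow -> vertex;
  target : arrow -> vertex
}.
Arguments source {q}.
Arguments target {q}.

Definition double_quiver (Q : quiver) : quiver :=
  @Quiver (vertex Q) (arrow Q + arrow Q)%type
    (fun a => match a with inl b => source b | inr b => target b end)
    (fun a => match a with inl b => target b | inr b => source b end).

(* [inl a] is the arrow a of Q and [inr a] is a^*. *)
Definition star (Q : quiver) (a : arrow (double_quiver Q)) : arrow (double_quiver Q) :=
  match a with inl b => inr b | inr b => inl b end.

Section Path.
Variable Q : quiver.

Fixpoint walk (v : vertex Q) (p : seq (arrow Q)) : bool :=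
  if p is a :: p' then (source a == v) && walk (target a) p' else true.

(* A path is a start vertex with a composable sequence of arrows; the empty
   sequence at v is the trivial path e_v. *)
Definition qpath := {p : vertex Q * seq (arrow Q) | walk p.1 p.2}.
HB.instance Definition _ := SubChoice.on qpath.

Definition path_src (p : qpath) : vertex Q := (val p).1.
Definition path_seq (p : qpath) : seq (arrow Q) := (val p).2.
Definition path_end (v : vertex Q) (s : seq (arrow Q)) := last v (map target s).
Definition path_tgt (p : qpath) : vertex Q := path_end (path_src p) (path_seq p).

Lemma walk_cat v s t : walk v (s ++ t) = walk v s && walk (path_end v s) t.
Proof. by elim: s v => //= a s IHs v; rewrite IHs andbA. Qed.

Lemma path_end_cat v s t : path_end v (s ++ t) = path_end (path_end v s) t.
Proof. by rewrite /path_end map_cat last_cat. Qed.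

(* Composition reads from left to right: pq is p followed by q. *)
Definition path_comp (p q : qpath) : option qpath :=
  if path_tgt p == path_src q
  then insub (path_src p, path_seq p ++ path_seq q) else None.

Definition path_triv (v : vertex Q) : qpath := Sub (v, [::]) isT.

Fact arrow_walk (a : arrow Q) : walk (source a) [:: a].
Proof. by rewrite /= eqxx. Qed.
Definition path_arrow (a : arrow Q) : qpath :=
  Sub (source a, [:: a]) (arrow_walk a).

Variant path_comp_spec (p q : qpath) : option qpath -> Prop :=
| PathComp r of path_tgt p = path_src q & path_src r = path_src p &
    path_seq r = path_seq p ++ path_seq q & path_tgt r = path_tgt q :
    path_comp_spec p q (Some r)
| PathNone of path_tgt p <> path_src q : path_comp_spec p q None.

Lemma path_compP p q : path_comp_spec p q (path_comp p q).
Proof.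
rewrite /path_comp; case: eqP => [e|ne]; last exact: PathNone.
case: insubP => [r _ er|/negP[]].
  apply: PathComp => //; rewrite /path_tgt /path_src /path_seq ?er //=.
  by rewrite path_end_cat -/(path_tgt p) e.
by rewrite /= walk_cat (valP p) -/(path_tgt p) e (valP q).
Qed.

Lemma path_eq p q : path_src p = path_src q -> path_seq p = path_seq q -> p = q.
Proof.
move=> e1 e2; apply: val_inj; rewrite [val p]surjective_pairing.
by rewrite [val q]surjective_pairing; congr pair.
Qed.

Lemma path_compA p q r :
  obind (path_comp^~ r) (path_comp p q) = obind (path_comp p) (path_comp q r).
Proof.
case: (path_compP p q) => [u e1 e2 e3 e4|n1] /=;
  case: (path_compP q r) => [w f1 f2 f3 f4|n2] //=.
- case: path_compP => [x g1 g2 g3 g4|]; last by rewrite e4.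
  case: path_compP => [y h1 h2 h3 h4|]; last by rewrite f2.
  by congr Some; apply: path_eq; rewrite ?g2 ?h2 ?g3 ?h3 ?e3 ?f3 ?catA.
- by case: path_compP => // x g1; rewrite e4 in g1.
- by case: path_compP => // x g1; rewrite f2 in g1.
Qed.

Lemma path_comp_trivl v p :
  path_comp (path_triv v) p = if v == path_src p then Some p else None.
Proof.
have tv : path_tgt (path_triv v) = v by [].
case: path_compP => [r|]; rewrite tv; last by move/eqP/negPf->.
by move=> -> e1 e2 _; rewrite eqxx; congr Some; apply: path_eq; rewrite ?e1 ?e2.
Qed.

Lemma path_comp_trivr p v :
  path_comp p (path_triv v) = if v == path_tgt p then Some p else None.
Proof.
have tv : path_src (path_triv v) = v by [].
case: path_compP => [r|]; rewrite tv; last by move/nesym/eqP/negPf->.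
by move=> <- e1 e2 _; rewrite eqxx; congr Some; apply: path_eq; rewrite ?e1 ?e2 ?cats0.
Qed.

End Path.

(* Bilinear products are associative and unital as soon as they are so on a
   spanning family. *)
Section BilinearProduct.
Variables (k : comNzRingType) (V : lmodType k) (B : Type) (e : B -> V).
Variable mul : V -> V -> V.
Hypothesis span_ind : forall P : V -> Prop,
  P 0 -> (forall c b x, P x -> P (c *: e b + x)) -> forall x, P x.
Hypothesis mull : forall c x y z, mul (c *: x + y) z = c *: mul x z + mul y z.
Hypothesis mulr : forall c x y z, mul z (c *: x + y) = c *: mul z x + mul z y.

Fact bilin_mulDl : left_distributive mul +%R.
Proof. by move=> x y z; have := mull 1 x y z; rewrite !scale1r. Qed.
Fact bilin_mulDr : right_distributive mul +%R.
Proof. by move=> x y z; have := mulr 1 y z x; rewrite !scale1r. Qed.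
Fact bilin_mul0l x : mul 0 x = 0.
Proof. by apply: (addIr (mul 0 x)); rewrite -bilin_mulDl !add0r. Qed.
Fact bilin_mul0r x : mul x 0 = 0.
Proof. by apply: (addIr (mul x 0)); rewrite -bilin_mulDr !add0r. Qed.
Fact bilin_mulZl c x y : mul (c *: x) y = c *: mul x y.
Proof. by rewrite -[c *: x]addr0 mull bilin_mul0l addr0. Qed.
Fact bilin_mulZr c x y : mul x (c *: y) = c *: mul x y.
Proof. by rewrite -[c *: y]addr0 mulr bilin_mul0r addr0. Qed.

Fact bilin_mulA :
  (forall a b c, mul (e a) (mul (e b) (e c)) = mul (mul (e a) (e b)) (e c)) ->
  associative mul.
Proof.
move=> eA x y z; elim/span_ind: x => [|c p x IHx]; first by rewrite !bilin_mul0l.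
rewrite !mull {}IHx; congr (_ *: _ + _).
elim/span_ind: y => [|d q y IHy]; first by rewrite !(bilin_mul0l, bilin_mul0r).
rewrite !(mull, mulr) {}IHy; congr (_ *: _ + _).
elim/span_ind: z => [|f r z IHz]; first by rewrite !bilin_mul0r.
by rewrite !mulr {}IHz eA.
Qed.

Variables (I : finType) (u : I -> V).
Fact bilin_mul1l :
  (forall b, \sum_i mul (u i) (e b) = e b) -> left_id (\sum_i u i) mul.
Proof.
move=> e1; elim/span_ind => [|c p x IHx]; first by rewrite bilin_mul0r.
rewrite mulr {}IHx; congr (_ *: _ + _); rewrite -[RHS]e1.
exact: (big_morph (mul^~ _) (fun _ _ => bilin_mulDl _ _ _) (bilin_mul0l _)).
Qed.
Fact bilin_mul1r :
  (forall b, \sum_i mul (e b) (u i) = e b) -> right_id (\sum_i u i) mul.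
Proof.
move=> e1; elim/span_ind => [|c p x IHx]; first by rewrite bilin_mul0l.
rewrite mull {}IHx; congr (_ *: _ + _); rewrite -[RHS]e1.
exact: (big_morph (mul _) (fun _ _ => bilin_mulDr _ _ _) (bilin_mul0r _)).
Qed.

End BilinearProduct.

Fact malgU_scale (k : comNzRingType) (K : choiceType) (c : k) (p : K) :
  << c *g p >> = c *: << (1 : k) *g p >> :> {malg k[K]}.
Proof.
by apply/malgP => q; rewrite mcoeffZ (mcoeffU p c q) (mcoeffU p 1 q) mulr_natr.
Qed.

Definition path_alg (k : comNzRingType) (Q : quiver) := {malg k[qpath Q]}.
HB.instance Definition _ (k : comNzRingType) (Q : quiver) :=
  GRing.Lmodule.on (path_alg k Q).

HB.lock Definition path_elt (k : comNzRingType) (Q : quiver) (p : qpath Q) :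
  path_alg k Q := << (1 : k) *g p >>.
Definition opath_elt (k : comNzRingType) (Q : quiver) (o : option (qpath Q)) :
  path_alg k Q := oapp (@path_elt k Q) 0 o.

HB.lock Definition path_mul (k : comNzRingType) (Q : quiver)
    (x y : path_alg k Q) : path_alg k Q :=
  \sum_(p <- msupp x) \sum_(q <- msupp y)
    (mcoeff p x * mcoeff q y) *: opath_elt k (path_comp p q).

Section PathAlgebra.
Variables (k : comNzRingType) (Q : quiver).
Local Notation path_alg := (path_alg k Q).
Local Notation path_elt := (@path_elt k Q).
Local Notation opath_elt := (@opath_elt k Q).
Local Notation path_mul := (@path_mul k Q).
Implicit Types (x y z : path_alg) (p q r : qpath Q).

Definition path_one : path_alg := \sum_(v : vertex Q) path_elt (path_triv v).

Let lin (f : qpath Q -> path_alg) x : path_alg := \sum_(p <- msupp x) mcoeff p x *: f p.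

Let linEw f x (d : {fset qpath Q}) : (msupp x `<=` d)%fset ->
  lin f x = \sum_(p <- d) mcoeff p x *: f p.
Proof.
move=> sxd; rewrite /lin; apply: big_fset_incl => // p _ /mcoeff_outdom ->.
by rewrite scale0r.
Qed.

Let linP f : linear (lin f).
Proof.
move=> c x y; set d := (msupp x `|` msupp y `|` msupp (c *: x + y))%fset.
rewrite !(linEw _ (d := d)) ?fsubsetUr //; last 2 first.
- by rewrite /d -fsetUA fsetUCA fsubsetUl.
- by rewrite /d -fsetUA fsubsetUl.
rewrite scaler_sumr -big_split; apply: eq_bigr => p _ /=.
by rewrite mcoeffD mcoeffZ scalerDl scalerA.
Qed.

Let linU f p : lin f (path_elt p) = f p.
Proof.
rewrite path_elt.unlock (linEw _ (d := [fset p]%fset)) ?msuppU_le //.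
by rewrite big_seq_fset1 mcoeffUU scale1r.
Qed.

Let lin_elt x : x = lin path_elt x.
Proof.
rewrite [LHS]monalgE; apply: eq_bigr => p _.
by rewrite path_elt.unlock; apply: malgU_scale.
Qed.

Let path_mulE x y :
  path_mul x y = lin (fun p => lin (fun q => opath_elt (path_comp p q)) y) x.
Proof.
rewrite path_mul.unlock; apply: eq_bigr => p _; rewrite scaler_sumr; apply: eq_bigr => q _.
by rewrite scalerA.
Qed.

Let path_ind (P : path_alg -> Prop) :
  P 0 -> (forall c p x, P x -> P (c *: path_elt p + x)) -> forall x, P x.
Proof.
move=> P0 PS x; rewrite (lin_elt x) /lin; elim: (enum_fset (msupp x)) => [|p s IHs].
  by rewrite big_nil.
by rewrite big_cons; apply: PS.
Qed.

Let path_mull c x y z :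
  path_mul (c *: x + y) z = c *: path_mul x z + path_mul y z.
Proof. by rewrite !path_mulE linP. Qed.

Let path_mulr c x y z :
  path_mul z (c *: x + y) = c *: path_mul z x + path_mul z y.
Proof.
rewrite !path_mulE /lin scaler_sumr -big_split; apply: eq_bigr => p _ /=.
by rewrite -!/(lin _ _) linP scalerDr !scalerA mulrC.
Qed.

Lemma path_mul_elt p q :
  path_mul (path_elt p) (path_elt q) = opath_elt (path_comp p q).
Proof. by rewrite path_mulE !linU. Qed.

Fact path_mulA : associative path_mul.
Proof.
apply: (bilin_mulA path_ind path_mull path_mulr) => p q r.
rewrite (path_mul_elt p q) (path_mul_elt q r).
transitivity (opath_elt (obind (path_comp p) (path_comp q r))).
  case: (path_comp q r) => [s|]; first exact: path_mul_elt.
  exact: (bilin_mul0r path_mulr).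
rewrite -path_compA; case: (path_comp p q) => [s|].
  by symmetry; apply: path_mul_elt.
by symmetry; apply: (bilin_mul0l path_mull).
Qed.

Fact path_mul1l : left_id path_one path_mul.
Proof.
apply: (bilin_mul1l path_ind path_mull path_mulr) => p.
under eq_bigr => v _ do rewrite path_mul_elt path_comp_trivl.
rewrite (bigD1 (path_src p)) //= eqxx big1 ?addr0 // => v /negPf ne.
by rewrite ne.
Qed.
Fact path_mul1r : right_id path_one path_mul.
Proof.
apply: (bilin_mul1r path_ind path_mull path_mulr) => p.
under eq_bigr => v _ do rewrite path_mul_elt path_comp_trivr.
rewrite (bigD1 (path_tgt p)) //= eqxx big1 ?addr0 // => v /negPf ne.
by rewrite ne.
Qed.
HB.instance Definition _ := GRing.Zmodule_isPzRing.Build path_alg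
  path_mulA path_mul1l path_mul1r
  (bilin_mulDl path_mull) (bilin_mulDr path_mulr).

Definition path_scalar (c : k) : path_alg := c *: (1 : path_alg).
Fact path_scalar_zmod : zmod_morphism path_scalar.
Proof. by move=> c d; rewrite /path_scalar scalerBl. Qed.

Let path_scalarl c x : path_scalar c * x = c *: x.
Proof. by rewrite -[in RHS](mul1r x); apply: (bilin_mulZl path_mull). Qed.
Let path_scalarr c x : x * path_scalar c = c *: x.
Proof. by rewrite -[in RHS](mulr1 x); apply: (bilin_mulZr path_mulr). Qed.

Fact path_scalar_monoid : monoid_morphism path_scalar.
Proof.
split=> [|c d]; first by rewrite /path_scalar scale1r.
by rewrite path_scalarl /path_scalar scalerA.
Qed.
HB.instance Definition _ :=
  GRing.isZmodMorphism.Build k path_alg path_scalar path_scalar_zmod.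
HB.instance Definition _ :=
  GRing.isMonoidMorphism.Build k path_alg path_scalar path_scalar_monoid.
Fact path_scalar_central c x : path_scalar c * x = x * path_scalar c.
Proof. by rewrite path_scalarl path_scalarr. Qed.
HB.instance Definition _ :=
  PzRing_hasScalar.Build k path_alg path_scalar_central.

End PathAlgebra.

Section MultiplicativePreprojective.
Variables (k : comNzRingType) (Q : quiver) (le : rel (arrow (double_quiver Q))).

Definition darrow (a : arrow (double_quiver Q)) : path_alg k (double_quiver Q) :=
  path_elt k (path_arrow a).

Definition loop_unit (a : arrow (double_quiver Q)) : path_alg k (double_quiver Q) :=
  1 + darrow a * darrow (star a).

Definition loc_path_alg : pzAlgType k := loc_alg loop_unit.

(* (1 + aa^* )^(epsilon a): the arrows [inr _] contribute the inverse. *)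
Definition rho_factor (a : arrow (double_quiver Q)) : loc_path_alg :=
  match a with
  | inl _ => loc_in loop_unit (loop_unit a)
  | inr _ => loc_inv loop_unit a
  end.

(* [le] is meant to be a total order; factors with smaller index come first. *)
Definition rho : loc_path_alg :=
  \prod_(a <- sort le (enum (arrow (double_quiver Q)))) rho_factor a.

Definition Lambda1 : pzAlgType k := alg_quot (fun x : loc_path_alg => x = rho - 1).

End MultiplicativePreprojective.

(* The i-th arrow joins i and i+1 modulo n+1, with orientation [o i]. *)
Definition An_tilde (n : nat) (o : 'I_n.+1 -> bool) : quiver :=
  @Quiver 'I_n.+1 'I_n.+1
    (fun i => if o i then i else ordS i)
    (fun i => if o i then ordS i else i).

Section CenterModel.
Variables (k : comNzRingType) (n : nat).
Let X : mpoly 3 k := 'X_0.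
Let Y : mpoly 3 k := 'X_1.
Let Z : mpoly 3 k := 'X_2.

Definition center_rel : mpoly 3 k := Z ^+ n.+1 + X * Y + X * Y * Z.
Definition center_model : pzAlgType k :=
  alg_quot (fun p : mpoly 3 k => p = center_rel).

End CenterModel.

(* Main.v *)
From HB Require Import structures.
From mathcomp Require Import all_boot all_algebra fraction.
From mathcomp.classical Require Import boolp.
From mathcomp Require Import finmap bigenough.
From mathcomp.multinomials Require Import ssrcomplements monalg mpoly.
Require Import Defs.

(** Idea.  Write [N = n + 1].  Twisting by a unit the downward arrow of each edge
    with [o i = false] makes all edges look alike, and the relation at each
    vertex becomes [u_i d_i = d_(i-1) u_(i-1)].  With [u] and [d] the sums of the
    upward and downward arrows, [u] and [d] commute, [1 + u d] is central and
    invertible, and [e_i u = u e_(i+1)], [e_(i+1) d = d e_i]: the algebra is the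
    smash product of [k[u, d][(1 + u d)^-1]] with the idempotents of the cycle.
    Every element is [(1 + u d)^-r] times a sum of [e_i p_i(u, d)], and letting
    a matrix representation act on the vector [(1, ..., 1)] recovers the [p_i].
    An element is central iff all [p_i] coincide and involve only monomials
    [u^a d^b] with [a = b] modulo [N].  So the center is generated by
    [u^N], [d^N], [u d] and [(1 + u d)^-1]; the variables of the model are sent
    to [X = - u^N (1 + u d)^-1], [Y = d^N], [Z = u d].  The relation of the model
    makes [1 + Z] invertible there: modulo [1 + Z] it reads [(-1)^N = 0]. *)

Set Implicit Arguments.
Unset Strict Implicit.
Unset Printing Implicit Defensive.

Import GRing.Theory BigEnough.
Local Open Scope ring_scope.

(** * Linear maps on polynomials and quotient algebras *)

Section LinearExtension.
Variables (k : comNzRingType) (A : pzAlgType k) (n : nat).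
Variable h : 'X_{1..n} -> A.

(** The values on monomials are arbitrary, which also covers the map to the model below that is not
    multiplicative; and the target may be noncommutative. *)
Definition mpoly_lin (p : mpoly n k) : A :=
  \sum_(m <- msupp p) scalar p@_m * h m.

Let mpoly_linE p i : (msize p <= i)%N ->
  mpoly_lin p = \sum_(m : 'X_{1..n < i}) scalar p@_m * h m.
Proof.
move=> le_pi; set I : subFinType _ := 'X_{1..n < i}.
rewrite /mpoly_lin (big_mksub I) ?msupp_uniq //=; first last.
  by move=> x /msize_mdeg_lt /leq_trans; apply.
rewrite big_rmcond //= => j /memN_msupp_eq0 ->.
by rewrite raddf0 mul0r.
Qed.

Fact mpoly_lin_zmod : zmod_morphism mpoly_lin.
Proof.
move=> p q; pose_big_enough i.
  rewrite !(mpoly_linE (i := i)) // -sumrB; apply: eq_bigr => m _.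
  by rewrite !raddfB /= mulrBl.
by close.
Qed.
HB.instance Definition _ :=
  GRing.isZmodMorphism.Build (mpoly n k) A mpoly_lin mpoly_lin_zmod.

Lemma mpoly_linX m : mpoly_lin 'X_[m] = h m.
Proof. by rewrite /mpoly_lin msuppX big_seq1 mcoeffX eqxx rmorph1 mul1r. Qed.

Lemma mpoly_linZ c p : mpoly_lin (c *: p) = scalar c * mpoly_lin p.
Proof.
pose_big_enough i.
  rewrite !(mpoly_linE (i := i)) // mulr_sumr; apply: eq_bigr => m _.
  by rewrite mcoeffZ rmorphM mulrA.
by close.
Qed.

Hypothesis h0 : h 0%MM = 1.
Hypothesis hD : forall m1 m2, h (m1 + m2)%MM = h m1 * h m2.

Lemma mpoly_lin_monoid : monoid_morphism mpoly_lin.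
Proof.
split=> [|p q]; first by rewrite -mpolyX0 mpoly_linX.
elim/mpolyind: p => [|c m p _ _ IHp]; first by rewrite mul0r raddf0 mul0r.
rewrite mulrDl !raddfD mulrDl /= {}IHp -scalerAl !mpoly_linZ; congr (_ + _).
rewrite -mulrA; congr (_ * _).
elim/mpolyind: q => [|d m' q _ _ IHq]; first by rewrite mulr0 raddf0 mulr0.
rewrite mulrDr !raddfD mulrDr /= {}IHq -scalerAr !mpoly_linZ -mpolyXD.
by rewrite !mpoly_linX hD !mulrA scalar_central.
Qed.

End LinearExtension.

(** The kernel of [f] is a two-sided ideal, so it contains the ideal generated by the relations. The
    lift is evaluated on chosen representatives. *)
Lemma quot_lift (k : comNzRingType) (A : pzAlgType k) (rel : A -> Prop)
    (M : pzRingType) (f : {rmorphism A -> M}) :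
  (forall x, rel x -> f x = 0) ->
  exists g : {rmorphism alg_quot rel -> M}, forall x, g (qproj rel x) = f x.
Proof.
move=> f0; pose g (x : alg_quot rel) := f (repr x).
have gE x : g (qproj rel x) = f x.
  apply/eqP; rewrite -subr_eq0 -rmorphB; apply/eqP.
  have /qproj_eq : qproj rel (repr (qproj rel x)) = qproj rel x.
    exact: qproj_repr.
  elim=> [|y z _ fy _ fz|y r z /f0 fr]; first exact: raddf0.
  - by rewrite raddfD /= fy fz addr0.
  - by rewrite !rmorphM fr mulr0 mul0r.
have gB : zmod_morphism g.
  move=> x y; case: (qproj_surj x) (qproj_surj y) => x' -> [y' ->].
  by rewrite -raddfB /= !gE raddfB.
have gM : monoid_morphism g.
  split=> [|x y]; first by rewrite -(rmorph1 (qproj rel)) gE rmorph1.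
  case: (qproj_surj x) (qproj_surj y) => x' -> [y' ->].
  by rewrite -rmorphM /= !gE rmorphM.
pose gz := GRing.isZmodMorphism.Build _ _ g gB.
pose gm := GRing.isMonoidMorphism.Build _ _ g gM.
pose G : {rmorphism alg_quot rel -> M} := HB.pack g gz gm.
by exists G.
Qed.

(** The inverse of [g] is obtained by choice from surjectivity, and injectivity of [g] makes it a
    ring morphism. *)
Lemma alg_isomorphic_bij (k : comNzRingType) (A B : pzAlgType k)
    (g : {rmorphism B -> A}) :
  (forall c, g (scalar c) = scalar c) ->
  (forall x, g x = 0 -> x = 0) -> (forall y, exists x, g x = y) ->
  alg_isomorphic A B.
Proof.
move=> gc g0 gs.
have gI : injective g.
  by move=> x y gxy; apply/subr0_eq/g0; rewrite raddfB /= gxy subrr.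
have [f fK] : exists f, cancel f g.
  by exists (fun y => projT1 (cid (gs y))) => y; case: cid.
have gK : cancel g f by move=> x; apply: gI; rewrite fK.
have fB : zmod_morphism f by move=> x y; apply: gI; rewrite raddfB /= !fK.
have fM : monoid_morphism f.
  by split=> [|x y]; apply: gI; rewrite ?rmorphM ?rmorph1 /= !fK.
pose fz := GRing.isZmodMorphism.Build _ _ f fB.
pose fm := GRing.isMonoidMorphism.Build _ _ f fM.
pose G : {rmorphism A -> B} := HB.pack f fz fm.
exists G; split; first by exists g.
by move=> c; rewrite -[LHS]/(f _) -gc gK.
Qed.

Fact mpoly_quot_mulC (k : comNzRingType) (m : nat) (rel : mpoly m k -> Prop) :
  commutative (@GRing.mul (alg_quot rel)).
Proof.
move=> x y; case: (qproj_surj x) (qproj_surj y) => p -> [q ->].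
by rewrite -!rmorphM mulrC.
Qed.
HB.instance Definition _ (k : comNzRingType) (m : nat) (rel : mpoly m k -> Prop) :=
  GRing.PzRing_hasCommutativeMul.Build (alg_quot rel) (@mpoly_quot_mulC k m rel).

Lemma mpoly_scalarE (k : comNzRingType) (m : nat) (c : k) :
  scalar c = c%:A :> mpoly m k.
Proof. by []. Qed.

Lemma qproj_scalar (k : comNzRingType) (A : pzAlgType k) (rel : A -> Prop) (c : k) :
  qproj rel (scalar c) = scalar c.
Proof. by []. Qed.

(** * Polynomials in two variables *)

Section Bivariate.
Variable k : comNzRingType.

Definition mnm2 (a b : nat) : 'X_{1..2} := [multinom if i == 0%R then a else b | i < 2].

Lemma mnm2E (m : 'X_{1..2}) : m = mnm2 (m 0) (m 1).
Proof.
apply/mnmP => i; rewrite mnmE; case: eqP => [-> //|].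
by case: i => [[|[|]]] //= lti ne; [case: ne | congr (m _)]; apply: val_inj.
Qed.

Lemma mpoly2X a b : 'X_0 ^+ a * 'X_1 ^+ b = 'X_[mnm2 a b] :> mpoly 2 k.
Proof.
rewrite [RHS]mpolyXE_id !big_ord_recl big_ord0 mulr1 !mnmE /=.
by congr (_ * 'X_ _ ^+ _); apply: val_inj.
Qed.

Lemma mpoly2_ind (P : mpoly 2 k -> Prop) :
  P 0 -> (forall c a b p, P p -> P (c *: ('X_0 ^+ a * 'X_1 ^+ b) + p)) ->
  forall p, P p.
Proof.
move=> P0 PS; elim/mpolyind => // c m p _ _ Pp.
by rewrite [m]mnm2E -mpoly2X; apply: PS.
Qed.

Variables (A : pzAlgType k) (f : nat -> nat -> A).

Definition mpoly2_lin : mpoly 2 k -> A := mpoly_lin (fun m => f (m 0) (m 1)).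
HB.instance Definition _ := GRing.Additive.on mpoly2_lin.

Lemma mpoly2_linX a b : mpoly2_lin ('X_0 ^+ a * 'X_1 ^+ b) = f a b.
Proof. by rewrite mpoly2X [LHS]mpoly_linX !mnmE. Qed.

Lemma mpoly2_linZ c p : mpoly2_lin (c *: p) = scalar c * mpoly2_lin p.
Proof. exact: mpoly_linZ. Qed.

Lemma mpoly2_lin_monoid :
  f 0 0 = 1 ->
  (forall a b a' b', f (a + a')%N (b + b')%N = f a b * f a' b') ->
  monoid_morphism mpoly2_lin.
Proof.
move=> f1 fD; apply: mpoly_lin_monoid => [|m m']; first by rewrite !mnm0E.
by rewrite !mnmDE.
Qed.

End Bivariate.

(** * The commutative model *)

Section Model.
Variables (k : comNzRingType) (n : nat).
Local Notation N := n.+1.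
Local Notation model := (alg_quot (fun p : mpoly 3 k => p = center_rel k n)).

Definition modelX : model := qproj _ ('X_0 : mpoly 3 k).
Definition modelY : model := qproj _ ('X_1 : mpoly 3 k).
Definition modelZ : model := qproj _ ('X_2 : mpoly 3 k).

(* [modelU], [modelY], [modelZ] play the roles of [u ^+ N], [d ^+ N], [u * d]. *)
Definition modelU : model := - (modelX * (1 + modelZ)).

Lemma model_rel : modelZ ^+ N + modelX * modelY + modelX * modelY * modelZ = 0.
Proof.
rewrite /modelX /modelY /modelZ -rmorphXn -!rmorphM -!rmorphD /=.
rewrite -[RHS](rmorph0 (qproj _)); apply/qproj_eq.
by rewrite subr0 -[X in ideal_spec _ X]mulr1 -[X in X * 1]mul1r; apply: IdealM.
Qed.

(** The relation is [Z ^+ N + X * Y * (1 + Z) = 0]; absorbing [1 + Z] and the sign into [U] makes it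
    binomial, like [u ^+ N * d ^+ N = (u * d) ^+ N]. *)
Lemma model_mulUY : modelU * modelY = modelZ ^+ N.
Proof.
apply/esym/subr0_eq; rewrite /modelU mulNr opprK -model_rel mulrDr mulr1 mulrDl addrA.
by rewrite (mulrAC modelX).
Qed.

(** Let [S] be the sum of the [(- Z) ^+ i] for [i < N]. Then [(1 + Z) * S = 1 - (-1) ^+ N * Z ^+ N],
    and the relation replaces [Z ^+ N] by [- (1 + Z) * X * Y]; hence [1 + Z] divides 1. *)
Lemma model_unit : exists v : model, v * (1 + modelZ) = 1.
Proof.
have e : (1 + modelZ) * \sum_(i < N) (- modelZ) ^+ i = 1 - (- modelZ) ^+ N.
  by rewrite -[1 + _]opprK opprD addrC mulNr -subrX1 opprB.
exists (\sum_(i < N) (- modelZ) ^+ i - (-1) ^+ N * (modelX * modelY)).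
rewrite mulrC mulrBr e [(- modelZ) ^+ N]exprNn [X in _ - X]mulrCA -addrA -opprD -mulrDr.
have -> : modelZ ^+ N + (1 + modelZ) * (modelX * modelY) = 0.
  by rewrite mulrC mulrDr mulr1 addrA model_rel.
by rewrite mulr0 subr0.
Qed.

(* The image of [u ^+ a * d ^+ b]; one of the truncated differences is 0. *)
Definition model_monom (a b : nat) : model :=
  if a == b %[mod N] then
    modelU ^+ ((a - b) %/ N) * modelY ^+ ((b - a) %/ N) * modelZ ^+ minn a b
  else 0.

Lemma model_monomSS a b : model_monom a.+1 b.+1 = modelZ * model_monom a b.
Proof.
rewrite /model_monom !subSS minnSS -(addn1 a) -(addn1 b) eqn_modDr.
by case: ifP => _; rewrite ?mulr0 // exprS mulrCA.
Qed.

(** The smaller of [a] and [b] is hidden in the power [Z ^+ (N * minn a b)], which equals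
    [(U * Y) ^+ minn a b]. *)
Lemma model_monomE a b c :
  model_monom (N * a + c) (N * b + c) = modelU ^+ a * modelY ^+ b * modelZ ^+ c.
Proof.
rewrite /model_monom eqn_modDr !modnMr eqxx !subnDr -!mulnBr !mulKn //.
rewrite -addn_minl -minnMr exprD mulrA; congr (_ * _).
case: (leqP a b) => [|/ltnW] leab.
  rewrite (eqP leab) expr0 mul1r exprM -model_mulUY exprMn.
  by rewrite mulrCA -exprD subnK.
rewrite (eqP leab) expr0 mulr1 exprM -model_mulUY exprMn.
by rewrite mulrA -exprD subnK.
Qed.

(** A lift to the model of the map [x |-> \sum_i e i * x * e i], which keeps the monomials with
    [a = b] modulo [N]. It is linear, but in general not multiplicative. *)
Definition model_proj : mpoly 2 k -> model := mpoly2_lin model_monom.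
HB.instance Definition _ := GRing.Additive.on model_proj.

Lemma model_projE a b : model_proj ('X_0 ^+ a * 'X_1 ^+ b) = model_monom a b.
Proof. exact: mpoly2_linX. Qed.

Lemma model_proj0 : model_proj 0 = 0.
Proof. exact: raddf0. Qed.

Lemma model_projD p q : model_proj (p + q) = model_proj p + model_proj q.
Proof. exact: raddfD. Qed.

Lemma model_projZ c q : model_proj (c *: q) = scalar c * model_proj q.
Proof. exact: mpoly2_linZ. Qed.

(** Multiplication by ['X_0 * 'X_1] raises both exponents and keeps their difference, so the
    projection is linear over the denominators. *)
Lemma model_projM q :
  model_proj ((1 + 'X_0 * 'X_1) * q) = (1 + modelZ) * model_proj q.
Proof.
rewrite !mulrDl !mul1r raddfD /=; congr (_ + _).
elim/mpoly2_ind: q => [|c a b q IHq]; first by rewrite !mulr0 raddf0 mulr0.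
rewrite mulrDr !raddfD mulrDr /= {}IHq -scalerAr; congr (_ + _).
rewrite !model_projZ [RHS]mulrCA; congr (_ * _).
by rewrite mulrACA -!exprS !model_projE model_monomSS.
Qed.

Lemma model_projXM r q :
  model_proj ((1 + 'X_0 * 'X_1) ^+ r * q) = (1 + modelZ) ^+ r * model_proj q.
Proof.
by elim: r => [|r IHr]; rewrite ?mul1r // !exprS -!mulrA model_projM IHr.
Qed.

Lemma model_ind (P : model -> Prop) :
  P 0 -> (forall c m b, P b -> P (scalar c * qproj _ ('X_[m] : mpoly 3 k) + b)) ->
  forall b, P b.
Proof.
move=> P0 PS b; case: (qproj_surj b) => p -> {b}.
elim/mpolyind: p => [|c m p _ _ Pp]; first by rewrite rmorph0.
rewrite rmorphD -[_ *: _]mulr_algl -mpoly_scalarE rmorphM /= qproj_scalar.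
exact: PS.
Qed.

(** Each factor [X * (1 + Z)] is [- U], so the power of [1 + Z] trades [X] for [U] up to sign, and a
    single [model_monom] results. *)
Lemma model_clear (m : 'X_{1..3}) :
  (1 + modelZ) ^+ m 0 * qproj _ ('X_[m] : mpoly 3 k) =
  (-1) ^+ m 0 * model_monom (N * m 0 + m 2%:R) (N * m 1 + m 2%:R) :> model.
Proof.
have i1 : lift ord0 ord0 = 1 :> 'I_3 by apply: val_inj.
have i2 : lift ord0 (lift ord0 ord0) = 2%:R :> 'I_3 by apply: val_inj.
rewrite mpolyXE_id !big_ord_recl big_ord0 mulr1 i1 i2 !rmorphM !rmorphXn /=.
rewrite -/modelX -/modelY -/modelZ model_monomE.
have clear (R : comPzRingType) (x y z : R) a b c :
    (1 + z) ^+ a * (x ^+ a * (y ^+ b * z ^+ c)) =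
    (-1) ^+ a * ((- (x * (1 + z))) ^+ a * y ^+ b * z ^+ c).
  by rewrite (exprNn (x * (1 + z))) exprMn -!mulrA signrMK mulrCA.
exact: clear.
Qed.

End Model.

Fact center_mulC (k : comNzRingType) (A : pzAlgType k) :
  commutative (@GRing.mul (center_alg A)).
Proof. by move=> x y; apply: val_inj; have /centerP := valP x; apply. Qed.
HB.instance Definition _ (k : comNzRingType) (A : pzAlgType k) :=
  GRing.PzRing_hasCommutativeMul.Build (center_alg A) (@center_mulC k A).

Lemma val_iter_ordS n (i : 'I_n.+1) m :
  iter m (@ordS n.+1) i = ((i + m) %% n.+1)%N :> nat.
Proof.
elim: m => [|m IHm] /=; first by rewrite addn0 modn_small.
by rewrite IHm addnS -[in RHS](addn1 (i + m)) -[in RHS]modnDml addn1.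
Qed.

(** * The center of a cyclic algebra *)

Section CyclicAlgebra.
Variables (k : fieldType) (n : nat) (L : pzAlgType k).
Local Notation N := n.+1.
Variables (F : fieldType) (iota : {rmorphism mpoly 2 k -> F}).
Hypothesis iota_inj : injective iota.
Variables (e : 'I_N -> L) (u d zeta : L).
Hypothesis e_orth : forall i j, e i * e j = e i *+ (i == j).
Hypothesis e_sum : \sum_i e i = 1.
Hypothesis eu : forall i, e i * u = u * e (ordS i).
Hypothesis ed : forall i, e (ordS i) * d = d * e i.
Hypothesis udC : GRing.comm u d.
Hypothesis zetaP : zeta * (1 + u * d) = 1.
Hypothesis zetaP' : (1 + u * d) * zeta = 1.
Hypothesis gen : forall P : L -> Prop,
  (forall x y, P x -> P y -> P (x + y)) -> (forall x y, P x -> P y -> P (x * y)) ->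
  (forall c, P (scalar c)) -> (forall i, P (e i)) -> P u -> P d -> P zeta ->
  forall x, P x.
(** Weighted cyclic shifts over a field containing [k[X, Y]]; they serve to show that normal forms
    are unique. *)
Variable phi : {rmorphism L -> 'M[F]_N}.
Hypothesis phi_e : forall i (v : 'cV[F]_N) j,
  (phi (e i) *m v) j 0 = v j 0 *+ (i == j) :> F.
Hypothesis phi_u : forall (v : 'cV[F]_N) j,
  (phi u *m v) j 0 = iota 'X_0 * v (ordS j) 0.
Hypothesis phi_d : forall (v : 'cV[F]_N) j,
  (phi d *m v) (ordS j) 0 = iota 'X_1 * v j 0.
Hypothesis phi_scalar : forall c, phi (scalar c) = (iota c%:MP)%:M.

Let e_u i m : e i * u ^+ m = u ^+ m * e (iter m (@ordS N) i).
Proof.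
elim: m => [|m IHm]; first by rewrite mulr1 mul1r.
by rewrite exprSr mulrA IHm -!mulrA eu.
Qed.

Let e_d i m : e (iter m (@ordS N) i) * d ^+ m = d ^+ m * e i.
Proof.
elim: m => [|m IHm]; first by rewrite mulr1 mul1r.
by rewrite exprS mulrA iterS ed -!mulrA IHm.
Qed.

Let iter_ordSN i : iter N (@ordS N) i = i.
Proof. by apply: val_inj; rewrite [LHS]val_iter_ordS modnDr modn_small. Qed.

(** Moving both idempotents to the middle gives the product of those at [i + a] and [i + b], which
    vanishes unless these indices agree modulo [N]. *)
Let e_ud i a b :
  e i * (u ^+ a * d ^+ b) * e i = (e i * (u ^+ a * d ^+ b)) *+ (a == b %[mod N])%N.
Proof.
rewrite [e i * _]mulrA e_u -!mulrA -(e_d i b) [e _ * (e _ * _)]mulrA e_orth.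
rewrite -val_eqE /= !val_iter_ordS eqn_modDl.
by case: eqP => _; rewrite ?mulr1n // !mulr0n mul0r mulr0.
Qed.

Let udE : u * d = d * u := udC.

Let comm_e i : GRing.comm (u * d) (e i).
Proof.
have [j ->] : exists j, i = ordS j by exists (ord_pred i); rewrite ord_predK.
by rewrite /GRing.comm udE -mulrA -eu mulrA -ed mulrA.
Qed.

Let comm_u : GRing.comm (u * d) u.
Proof. by rewrite /GRing.comm -mulrA -udE. Qed.

Let comm_d : GRing.comm (u * d) d.
Proof. by rewrite /GRing.comm {1}udE mulrA. Qed.

Let central x : (forall i, GRing.comm x (e i)) -> GRing.comm x u ->
  GRing.comm x d -> forall y, GRing.comm x y.
Proof.
move=> xe xu xd; apply: gen => // [y z|y z|c|].
- exact: commrD.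
- exact: commrM.
- by rewrite /GRing.comm scalar_central.
(* [x] commutes with [1 + u * d], hence with its inverse [zeta]. *)
- rewrite /GRing.comm -[LHS]mul1r -zetaP -!mulrA; congr (_ * _).
  rewrite mulrA -[_ * x]commrD; [|exact: commr1|exact: commrM].
  by rewrite -mulrA zetaP' mulr1.
Qed.

Let ud_central y : GRing.comm (u * d) y.
Proof. exact: central. Qed.
Let t_central y : GRing.comm (1 + u * d) y.
Proof. by apply/commr_sym/commrD; [exact: commr1 | exact/commr_sym]. Qed.
Let tX_central r y : (1 + u * d) ^+ r * y = y * (1 + u * d) ^+ r.
Proof. exact/commr_sym/commrX/commr_sym. Qed.
Let zeta_central y : GRing.comm zeta y.
Proof.
rewrite /GRing.comm -[RHS]mul1r -zetaP -!mulrA; congr (_ * _).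
by rewrite mulrA t_central -mulrA zetaP' mulr1.
Qed.
Let uN_central y : GRing.comm (u ^+ N) y.
Proof.
apply: central => [i||]; last first.
- exact/commr_sym/commrX/commr_sym.
- exact/commr_sym/commrX.
- by rewrite /GRing.comm e_u iter_ordSN.
Qed.
Let dN_central y : GRing.comm (d ^+ N) y.
Proof.
apply: central => [i||]; last first.
- exact/commr_sym/commrX.
- exact/commr_sym/commrX.
- by rewrite /GRing.comm -[in RHS](iter_ordSN i) e_d.
Qed.

Definition eval_ud : mpoly 2 k -> L := mpoly2_lin (fun a b => u ^+ a * d ^+ b).
Local Notation psi := eval_ud.

Let psi_monoid : monoid_morphism psi.
Proof.
apply: mpoly2_lin_monoid => [|a b a' b']; first by rewrite mul1r.
rewrite !exprD !mulrA; congr (_ * _); rewrite -!mulrA; congr (_ * _).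
exact/commrX/commr_sym/commrX/commr_sym.
Qed.
HB.instance Definition _ := GRing.Additive.on psi.
HB.instance Definition _ :=
  GRing.isMonoidMorphism.Build (mpoly 2 k) L psi psi_monoid.

Let psiZ c p : psi (c *: p) = scalar c * psi p.
Proof. exact: mpoly2_linZ. Qed.
Let psi_monom a b : psi ('X_0 ^+ a * 'X_1 ^+ b) = u ^+ a * d ^+ b.
Proof. exact: mpoly2_linX. Qed.
Let psi_u : psi 'X_0 = u.
Proof. by have := psi_monom 1 0; rewrite !mulr1. Qed.
Let psi_d : psi 'X_1 = d.
Proof. by have := psi_monom 0 1; rewrite !mul1r. Qed.

Let tau : mpoly 2 k := 1 + 'X_0 * 'X_1.
Let psi_tau : psi tau = 1 + u * d.
Proof. by rewrite rmorphD rmorph1 rmorphM /= psi_u psi_d. Qed.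

(** Clearing a power of the central unit [1 + u * d] keeps the coefficients polynomial. *)
Let norm_form x :=
  exists r p, (1 + u * d) ^+ r * x = \sum_i e i * psi (p i).

Let norm_scale s (p : 'I_N -> mpoly 2 k) :
  (1 + u * d) ^+ s * (\sum_i e i * psi (p i)) = \sum_i e i * psi (tau ^+ s * p i).
Proof.
rewrite mulr_sumr; apply: eq_bigr => i _.
rewrite rmorphM rmorphXn /= psi_tau !mulrA; congr (_ * _).
exact/commr_sym/commrX/commr_sym.
Qed.

Let norm_formD x y : norm_form x -> norm_form y -> norm_form (x + y).
Proof.
move=> [r [p ep]] [s [q eq]].
exists (r + s)%N, (fun i => tau ^+ s * p i + tau ^+ r * q i).
under eq_bigr => i _ do rewrite raddfD mulrDr.
rewrite big_split /= -!norm_scale -ep -eq mulrDr !mulrA -!exprD.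
by rewrite (addnC s).
Qed.

(** Left multiplication by [x] moves the component at [i] to [f i]; components landing on the same
    idempotent are added, whence the sum over a fibre of [f]. *)
Let norm_form_mul x (f : 'I_N -> 'I_N) (P : 'I_N -> mpoly 2 k) :
  (forall i, x * e i = e (f i) * psi (P i)) ->
  forall y, norm_form y -> norm_form (x * y).
Proof.
move=> xe y [r [p ep]]; exists r, (fun j => \sum_(i | f i == j) P i * p i).
rewrite mulrA tX_central -mulrA ep mulr_sumr.
rewrite (partition_big f xpredT) //=; apply: eq_bigr => j _.
rewrite raddf_sum mulr_sumr; apply: eq_bigr => i /eqP <- /=.
by rewrite mulrA xe rmorphM mulrA.
Qed.

Let norm_form_all x : norm_form x.
Proof.
(* Preserving normal forms under left multiplication is a property visibly closed under products;
   applied to 1 it gives the claim. *)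
suff nf : forall y, norm_form y -> norm_form (x * y).
  rewrite -[x]mulr1; apply: nf; exists 0%N, (fun=> 1).
  by rewrite mul1r -[LHS]e_sum; apply: eq_bigr => i _; rewrite rmorph1 mulr1.
elim/gen: x => [x y nx ny z nz|x y nx ny z nz|c|i|||y [r [p ep]]].
- by rewrite mulrDl; apply: norm_formD; [apply: nx|apply: ny].
- by rewrite -mulrA; apply/nx/ny.
- apply: (norm_form_mul (f := id) (P := fun=> c%:MP)) => i.
  by rewrite -[c%:MP]mulr1 mul_mpolyC psiZ rmorph1 mulr1 scalar_central.
- apply: (norm_form_mul (f := id) (P := fun j => (i == j)%:R)) => j.
  by rewrite e_orth rmorph_nat mulr_natr; case: eqP => // ->.
- apply: (norm_form_mul (f := @ord_pred N) (P := fun=> 'X_0)) => i.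
  by rewrite psi_u eu ord_predK.
- apply: (norm_form_mul (f := @ordS N) (P := fun=> 'X_1)) => i.
  by rewrite psi_d ed.
- exists r.+1, p; rewrite exprSr -mulrA.
  by rewrite [X in _ * X]mulrA zetaP' mul1r.
Qed.

Local Notation ones := (const_mx 1 : 'cV[F]_N).

Let phi_u_const f : phi u *m const_mx f = const_mx (iota 'X_0 * f) :> 'cV_N.
Proof. by apply/matrixP => i j; rewrite ord1 phi_u !mxE. Qed.

Let phi_d_const f : phi d *m const_mx f = const_mx (iota 'X_1 * f) :> 'cV_N.
Proof.
by apply/matrixP => i j; rewrite ord1 -(ord_predK i) phi_d !mxE.
Qed.

(* Acting on the all-one vector, the shifts carried by [u] and [d] disappear. *)
Let phi_psi p : phi (psi p) *m ones = const_mx (iota p).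
Proof.
elim/mpoly2_ind: p => [|c a b p IHp].
  by rewrite !rmorph0 mul0mx; apply/matrixP => i j; rewrite !mxE.
have phi_d_X : phi (d ^+ b) *m ones = const_mx (iota ('X_1 ^+ b)).
  elim: b => [|b IHb]; first by rewrite !rmorph1 mul1mx.
  by rewrite !exprS (rmorphM phi) /= -mulmxA IHb phi_d_const -rmorphM.
have phi_ud_X : phi (u ^+ a * d ^+ b) *m ones =
    const_mx (iota ('X_0 ^+ a * 'X_1 ^+ b)).
  elim: a => [|a IHa]; first by rewrite !mul1r.
  rewrite !exprS -!mulrA (rmorphM phi) /= -mulmxA IHa phi_u_const.
  by rewrite -rmorphM.
rewrite !raddfD mulmxDl /= {}IHp psiZ rmorphM /= psi_monom -mulmxA phi_ud_X.
rewrite phi_scalar mul_scalar_mx -mul_mpolyC.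
by apply/matrixP => i j; rewrite !mxE -rmorphM.
Qed.

(** [e j] selects the coordinate [j], where the coefficient [p j] can be read off. *)
Let phi_norm (p : 'I_N -> mpoly 2 k) j :
  (phi (\sum_i e i * psi (p i)) *m ones) j 0 = iota (p j).
Proof.
rewrite rmorph_sum mulmx_suml summxE (bigD1 j) //= big1 ?addr0 => [|i ne].
  by rewrite rmorphM -mulmxA phi_e eqxx phi_psi mxE.
by rewrite rmorphM -mulmxA phi_e (negPf ne).
Qed.

Let norm_inj (p q : 'I_N -> mpoly 2 k) :
  \sum_i e i * psi (p i) = \sum_i e i * psi (q i) -> p =1 q.
Proof.
move=> epq i; apply: iota_inj.
by rewrite -!phi_norm epq.
Qed.

Let psi_inj : injective psi.
Proof.
move=> p q epq; apply: (@norm_inj (fun=> p) (fun=> q) _ 0).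
by rewrite epq.
Qed.

Let in_centerX : in_center (- (u ^+ N * zeta)).
Proof.
apply/centerP => y; apply/commr_sym/commrN/commrM; apply/commr_sym.
  exact: uN_central.
exact: zeta_central.
Qed.
Let in_centerY : in_center (d ^+ N).
Proof. by apply/centerP => y; apply: dN_central. Qed.
Let in_centerZ : in_center (u * d).
Proof. by apply/centerP => y; apply: ud_central. Qed.

Let cX : center_alg L := Sub _ in_centerX.
Let cY : center_alg L := Sub _ in_centerY.
Let cZ : center_alg L := Sub _ in_centerZ.

Let duX_comm a b : d ^+ a * u ^+ b = u ^+ b * d ^+ a.
Proof. exact/esym/commrX/commr_sym/commrX/commr_sym. Qed.

Let ud_exp m : (u * d) ^+ m = u ^+ m * d ^+ m.
Proof. exact: exprMn_comm. Qed.

Let model_to_center : exists g : {rmorphism center_model k n -> center_alg L},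
  [/\ forall c, g (scalar c) = scalar c, g (modelX k n) = cX,
      g (modelY k n) = cY & g (modelZ k n) = cZ].
Proof.
pose h (m : 'X_{1..3}) := cX ^+ m 0 * cY ^+ m 1 * cZ ^+ m 2%:R.
have hm : monoid_morphism (mpoly_lin h).
  apply: mpoly_lin_monoid => [|m m']; rewrite /h; first by rewrite !mnm0E !mulr1.
  rewrite !mnmDE !exprD [RHS]mulrACA; congr (_ * _).
  by rewrite [RHS]mulrACA.
pose hM := GRing.isMonoidMorphism.Build _ _ (mpoly_lin h) hm.
pose H : {rmorphism mpoly 3 k -> center_alg L} := HB.pack (mpoly_lin h) hM.
have HX : H 'X_0 = cX.
  by rewrite [LHS]mpoly_linX /h !mnm1E /= expr1 !mulr1.
have HY : H 'X_1 = cY.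
  by rewrite [LHS]mpoly_linX /h !mnm1E /= expr1 mul1r mulr1.
have HZ : H 'X_2 = cZ.
  by rewrite [LHS]mpoly_linX /h !mnm1E /= expr1 !mul1r.
have [|g gE] := @quot_lift _ _ (fun p : mpoly 3 k => p = center_rel k n) _ H.
  move=> _ ->; rewrite /center_rel !rmorphD !rmorphM rmorphXn HX HY HZ.
  (* The two terms in [X * Y] combine to [X * Y * (1 + Z)], where [1 + u * d] cancels the [zeta] of
     [cX]. *)
  apply: val_inj => /=; rewrite -addrA -[X in _ + (X + _)]mulr1 -mulrDr.
  rewrite -mulrA mulNr -mulrA -(tX_central 1).
  rewrite expr1 [zeta * _]mulrA zetaP mul1r -[sval _]/(val (cZ ^+ N)) rmorphXn /=.
  by rewrite ud_exp subrr.
exists g; split => [c|||]; rewrite ?gE //.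
rewrite -[X in H X]/(c *: 1) [LHS]mpoly_linZ.
by rewrite -mpolyX0 mpoly_linX /h !mnm0E !mulr1.
Qed.

Theorem cyclic_center : alg_isomorphic (center_alg L) (center_model k n).
Proof.
have [g [gc gX gY gZ]] := model_to_center.
have [G GE] : exists G : {rmorphism center_model k n -> L}, forall b, G b = val (g b).
  by exists (val \o g).
have GX : G (modelX k n) = - (u ^+ N * zeta) by rewrite GE gX.
have GY : G (modelY k n) = d ^+ N by rewrite GE gY.
have GZ : G (modelZ k n) = u * d by rewrite GE gZ.
have Gc c : G (scalar c) = scalar c by rewrite GE gc.
have GU : G (modelU k n) = u ^+ N.
  rewrite rmorphN rmorphM rmorphD rmorph1 /= GX GZ mulNr opprK.
  by rewrite -mulrA zetaP mulr1.
(* The image of [model_monom] is the diagonal part of [u ^+ a * d ^+ b], the sum of its compressions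
   by the idempotents. *)
have G_monom a b : G (model_monom k n a b) = \sum_i e i * (u ^+ a * d ^+ b) * e i.
  rewrite (eq_bigr _ (fun i _ => e_ud i a b)) sumrMnl -mulr_suml e_sum mul1r.
  rewrite /model_monom; case: ifP => [eqab|_]; last by rewrite rmorph0.
  rewrite mulr1n !rmorphM !rmorphXn /= GU GY GZ ud_exp -!exprM.
  have [leab|/ltnW leab] := leqP a b.
    have /eqP -> : (a - b == 0)%N by [].
    rewrite div0n muln0 mul1r [(N * _)%N]mulnC divnK -?eqn_mod_dvd // 1?eq_sym //.
    by rewrite mulrA duX_comm -mulrA -exprD subnK.
  have /eqP -> : (b - a == 0)%N by [].
  rewrite div0n muln0 mulr1 [(N * _)%N]mulnC divnK -?eqn_mod_dvd //.
  by rewrite mulrA -exprD subnK.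
have G_proj q : G (model_proj n q) = \sum_i e i * psi q * e i.
  elim/mpoly2_ind: q => [|c a b q IHq].
    by rewrite !raddf0 big1 // => i _; rewrite mulr0 mul0r.
  rewrite model_projD rmorphD /= {}IHq.
  under [RHS]eq_bigr => i _ do rewrite raddfD mulrDr mulrDl.
  rewrite big_split; congr (_ + _).
  rewrite model_projZ model_projE rmorphM Gc G_monom /=.
  rewrite mulr_sumr; apply: eq_bigr => i _.
  by rewrite psiZ psi_monom !mulrA scalar_central.
have G1Z : G (1 + modelZ k n) = 1 + u * d by rewrite rmorphD rmorph1 GZ.
(* Multiplied by a power of the unit [1 + Z], every element of the model becomes some
   [model_proj n q] with image [psi q]; injectivity then reduces to that of [psi]. *)
have clear b : exists r q, (1 + modelZ k n) ^+ r * b = model_proj n q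
    /\ psi q = G (model_proj n q).
  elim/model_ind: b => [|c m b [r [q [eb eq]]]].
    by exists 0%N, 0; rewrite mulr0 model_proj0 !rmorph0.
  pose q' : mpoly 2 k := ((-1) ^+ m 0 * c) *:
    ('X_0 ^+ (N * m 0 + m 2%:R) * 'X_1 ^+ (N * m 1 + m 2%:R)).
  have eb' : (1 + modelZ k n) ^+ m 0 * (scalar c * qproj _ 'X_[m]) = model_proj n q'.
    rewrite mulrCA model_clear model_projZ model_projE.
    by rewrite rmorphM rmorphXn rmorphN1 mulrA [_ * scalar c]mulrC.
  have eq' : psi q' = G (model_proj n q').
    rewrite G_proj /q' psiZ psi_monom -[LHS]mul1r -e_sum mulr_suml.
    apply: eq_bigr => i _.
    rewrite !mulrA -!scalar_central -!mulrA; congr (_ * _).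
    rewrite [in RHS]mulrA [in RHS]mulrA -[_ * _ * _ ^+ _]mulrA e_ud.
    by rewrite eqn_modDr !modnMr eqxx.
  exists (r + m 0%R)%N, (tau ^+ r * q' + tau ^+ m 0 * q).
  rewrite model_projD raddfD rmorphD /= !model_projXM -eb -eb'.
  split; first by rewrite mulrDr !mulrA -!exprD (addnC (m 0%R)).
  rewrite !rmorphM !rmorphXn /= eq eq' -eb -eb' !rmorphM !rmorphXn.
  by rewrite psi_tau G1Z.
have [v vZ] := model_unit k n.
apply: (alg_isomorphic_bij gc) => [b gb0|x].
- have [r [q [eb eq]]] := clear b.
  suff q0 : q = 0.
    rewrite -[b]mul1r -(expr1n _ r) -vZ exprMn -mulrA eb q0.
    by rewrite model_proj0 mulr0.
  apply: psi_inj; rewrite eq -eb rmorph0 rmorphM /=.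
  by rewrite [G b]GE gb0 mulr0.
have [r [p ep]] := norm_form_all (val x).
have xC y : val x * y = y * val x by have /centerP := valP x; apply.
(* The coefficients of [e i] in [u * x] and [x * u] are compared; in the first, the index of [p] is
   shifted by one step. *)
have pS i : p (ordS i) = p i.
  have ep' : (1 + u * d) ^+ r * (u * val x) = \sum_i e i * psi ('X_0 * p (ordS i)).
    rewrite mulrA tX_central -mulrA ep mulr_sumr.
    rewrite (reindex_inj (@ordS_inj N)); apply: eq_bigr => j _.
    by rewrite mulrA -eu -mulrA rmorphM /= psi_u.
  have ep'' : (1 + u * d) ^+ r * (val x * u) = \sum_i e i * psi ('X_0 * p i).
    rewrite mulrA ep mulr_suml; apply: eq_bigr => j _.
    by rewrite [_ * p j]mulrC rmorphM /= psi_u mulrA.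
  have X0 : ('X_0 : mpoly 2 k) != 0 by rewrite -msupp_eq0 msuppX.
  apply: (mulfI X0).
  apply: (@norm_inj (fun i => 'X_0 * p (ordS i)) (fun i => 'X_0 * p i)).
  by rewrite -ep' -ep'' xC.
have p0 i : p i = p 0.
  have -> : i = iter i (@ordS N) 0.
    by apply: val_inj; rewrite [RHS]val_iter_ordS add0n modn_small.
  by elim: (i : nat) => //= m <-; apply: pS.
have [w wE] : exists w, w = (1 + u * d) ^+ r * val x by eexists.
(* [w] is central, so it equals its own diagonal part, and that is the image of
   [model_proj n (p 0)]. *)
have wG : w = G (model_proj n (p 0)).
  have wC y : w * y = y * w.
    by rewrite wE -mulrA xC mulrA tX_central mulrA.
  have {}ep : w = psi (p 0).
    rewrite wE ep; under eq_bigr => i _ do rewrite p0.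
    by rewrite -mulr_suml e_sum mul1r.
  rewrite G_proj -ep -[LHS]mul1r -e_sum mulr_suml; apply: eq_bigr => i _.
  by rewrite -mulrA wC mulrA e_orth eqxx.
have zr y : zeta ^+ r * ((1 + u * d) ^+ r * y) = y.
  rewrite mulrA -exprMn_comm; first by rewrite zetaP expr1n mul1r.
  exact: zeta_central.
(* The factor [v ^+ r] restores the denominator, as [v] is sent to [zeta]. *)
exists (v ^+ r * model_proj n (p 0)); apply: val_inj.
rewrite -GE rmorphM rmorphXn -wG wE /=.
have -> : G v = zeta.
  by rewrite -[LHS]mulr1 -zetaP' mulrA -G1Z -rmorphM vZ rmorph1 mul1r.
exact: zr.
Qed.
End CyclicAlgebra.

(** Since [x] commutes with all factors it can be moved next to each of them, and those that fix it
    disappear. The order of [a] and [b] in [s] decides between the alternatives. *)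
Lemma mul_prod_two (R : pzRingType) (I : eqType) (s : seq I) (x : R) (g : I -> R) a b :
  uniq s -> a \in s -> b \in s -> a != b -> (forall c, GRing.comm x (g c)) ->
  (forall c, c != a -> c != b -> x * g c = x) ->
  x * \prod_(c <- s) g c = x * (g a * g b) \/
  x * \prod_(c <- s) g c = x * (g b * g a).
Proof.
move=> us as_ bs ab xg x1.
have -> : x * \prod_(c <- s) g c = x * \prod_(c <- s | (c == a) || (c == b)) g c.
  elim: s {us as_ bs} => [|c s IHs]; first by rewrite !big_nil.
  rewrite !big_cons mulrA xg -mulrA IHs mulrA -xg.
  case: ifP => [_|/norP[ca cb]]; first by rewrite mulrA.
  by rewrite x1.
rewrite -big_filter; set t := filter _ _.
have ut : uniq t by rewrite filter_uniq.
have tE : t =i [:: a; b].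
  by move=> c; rewrite mem_filter !inE; case: eqP => [->|_]; case: eqP => [->|_].
have : perm_eq t [:: a; b] by rewrite uniq_perm //= inE ab.
move=> /perm_size; case: t ut tE => [|c [|c' [|]]] //= /andP[cc' _] tE _.
rewrite !big_cons big_nil mulr1.
have := tE c; have := tE c'; rewrite !inE !eqxx orbT /= => /esym c'E /esym cE.
move: cE c'E cc'; rewrite inE.
by case/orP=> /eqP -> /orP[]/eqP ->; rewrite ?eqxx //; [left | right].
Qed.

(** * Path algebras, localizations and their universal properties *)

Section FreeAlgebraTheory.
Variables (k : comNzRingType) (X : choiceType).

Let fmonomE (m : {fmonom X}) :
  << (1 : k) *g m >> = \prod_(x <- fmonom_val m) fvar k x :> free_alg k X.
Proof.
case: m => s /=; elim: s => [|x s IHs].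
  by rewrite big_nil -fmoneE.
rewrite big_cons -IHs [RHS]fgmulUU mul1r; congr << _ *g _ >>.
by apply: val_inj; rewrite /= fmM fmU.
Qed.

Lemma free_alg_ind (P : free_alg k X -> Prop) :
  (forall x y, P x -> P y -> P (x + y)) -> (forall x y, P x -> P y -> P (x * y)) ->
  (forall c, P (scalar c)) -> (forall x, P (fvar k x)) -> forall x, P x.
Proof.
move=> PD PM Pc Px x; rewrite [x]monalgE.
have P0 : P 0 by rewrite -(rmorph0 (@scalar k (free_alg k X))).
have P1 : P 1 by rewrite -(rmorph1 (@scalar k (free_alg k X))).
apply: big_ind => [||m _]; [exact: P0 | exact: PD |].
have -> : << monalg.mcoeff m x *g m >> =
    scalar (monalg.mcoeff m x) * (<< (1 : k) *g m >> : free_alg k X).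
  by rewrite [RHS]fgmulUU mul1m mulr1.
apply: (PM); first exact: Pc.
rewrite fmonomE.
by apply: (big_ind P P1 PM) => y _; apply: Px.
Qed.

(** Evaluation of noncommutative polynomials is multiplicative because the images of the scalars are
    central. *)
Lemma free_lift (M : nzRingType) (kappa : {rmorphism k -> M}) (f : X -> M) :
  (forall c x, GRing.comm (kappa c) x) ->
  exists g : {rmorphism free_alg k X -> M},
    (forall x, g (fvar k x) = f x) /\ (forall c, g (scalar c) = kappa c).
Proof.
move=> kC; pose h (m : {fmonom X}) := \prod_(x <- m) f x.
have hM : mmorphism h.
  by split=> [m m'|]; rewrite /h ?fm1 ?big_nil // fmM big_cat.
pose hm := isMultiplicative.Build _ _ h hM.
pose H : {mmorphism {fmonom X} -> M} := HB.pack h hm.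
have HM : monoid_morphism (monalg.mmap kappa H).
  have [] := @monalg.commr_mmap_is_multiplicative {fmonom X} k M kappa H.
    by move=> *; apply: kC.
  by move=> HM H1; split.
pose gM := GRing.isMonoidMorphism.Build _ _ (monalg.mmap kappa H) HM.
pose g : {rmorphism {malg k[{fmonom X}]} -> M} := HB.pack (monalg.mmap kappa H) gM.
exists g; split=> [x|c].
  by rewrite [LHS]monalg.mmapU [X in X * _](rmorph1 kappa) mul1r /= /h fmU big_seq1.
by rewrite [LHS]monalg.mmapU /= /h fm1 big_nil mulr1.
Qed.
End FreeAlgebraTheory.

Lemma quot_ind (k : comNzRingType) (A : pzAlgType k) (rel : A -> Prop)
    (P : alg_quot rel -> Prop) :
  (forall x, P (qproj rel x)) -> forall x, P x.
Proof. by move=> Pq x; case: (qproj_surj x) => y ->. Qed.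

Section LocalizationTheory.
Variables (k : comNzRingType) (A : pzAlgType k) (I : choiceType) (s : I -> A).

Lemma loc_ind (P : loc_alg s -> Prop) :
  (forall x y, P x -> P y -> P (x + y)) -> (forall x y, P x -> P y -> P (x * y)) ->
  (forall x, P (loc_in s x)) -> (forall i, P (loc_inv s i)) -> forall x, P x.
Proof.
move=> PD PM Pin Pinv; elim/quot_ind; elim/free_alg_ind => [x y|x y|c|[x|i]].
- by rewrite rmorphD; apply: PD.
- by rewrite rmorphM; apply: PM.
- by rewrite qproj_scalar -loc_in_scalar; apply: Pin.
- exact: Pin.
- exact: Pinv.
Qed.

Lemma loc_lift (M : nzRingType) (kappa : {rmorphism k -> M})
    (f : {rmorphism A -> M}) (w : I -> M) :
  (forall c x, GRing.comm (kappa c) x) -> (forall c, f (scalar c) = kappa c) ->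
  (forall i, f (s i) * w i = 1) -> (forall i, w i * f (s i) = 1) ->
  exists g : {rmorphism loc_alg s -> M},
    (forall x, g (loc_in s x) = f x) /\ (forall i, g (loc_inv s i) = w i).
Proof.
move=> kC fc fw wf.
have [h [hX hc]] := @free_lift k _ M kappa
  (fun x => match x with inl y => f y | inr i => w i end) kC.
have [|g gE] := @quot_lift k _ (loc_rel s) M h.
  move=> _ [x y|x y|c|i|i].
  - by rewrite rmorphB rmorphD /= !hX rmorphD subrr.
  - by rewrite rmorphB rmorphM /= !hX rmorphM subrr.
  - by rewrite rmorphB /= hX hc fc subrr.
  - by rewrite (rmorphB h) (rmorphM h) [X in _ - X](rmorph1 h) /= !hX fw subrr.
  - by rewrite (rmorphB h) (rmorphM h) [X in _ - X](rmorph1 h) /= !hX wf subrr.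
by exists g; split=> [x|i]; rewrite [LHS]gE hX.
Qed.

End LocalizationTheory.

Section PathAlgebraTheory.
Variables (k : comNzRingType) (Q : quiver).
Local Notation KQ := (path_alg k Q).

Lemma path_mcoeffE (x : KQ) :
  x = \sum_(p <- monalg.msupp x) monalg.mcoeff p x *: path_elt k p.
Proof.
rewrite [LHS]monalgE; apply: eq_bigr => p _.
by rewrite path_elt.unlock; apply: malgU_scale.
Qed.

Lemma path_eltM (p q : qpath Q) :
  path_elt k p * path_elt k q = opath_elt k (path_comp p q).
Proof. exact: path_mul_elt. Qed.

Lemma path_scaleE (c : k) (x : KQ) : scalar c * x = c *: x.
Proof.
rewrite -[in RHS](mul1r x) -[scalar c]/(c *: (1 : KQ)).
move: (1 : KQ) => y; rewrite -[LHS]/(path_mul _ _) -[_ * x]/(path_mul _ _).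
rewrite path_mul.unlock scaler_sumr (big_fset_incl _ (monalg.msuppZ_le c y)) /=.
  apply: eq_bigr => p _; rewrite scaler_sumr; apply: eq_bigr => q _.
  by rewrite monalg.mcoeffZ scalerA mulrA.
move=> p _ /monalg.mcoeff_outdom ->; apply: big1 => q _.
by rewrite mul0r scale0r.
Qed.

Lemma path_ind (P : KQ -> Prop) :
  (forall x y, P x -> P y -> P (x + y)) -> (forall x y, P x -> P y -> P (x * y)) ->
  (forall c, P (scalar c)) -> (forall v, P (path_elt k (path_triv v))) ->
  (forall a, P (path_elt k (path_arrow a))) -> forall x, P x.
Proof.
move=> PD PM Pc Pv Pa x; rewrite [x]path_mcoeffE.
have P0 : P 0 by rewrite -(rmorph0 (@scalar k KQ)).
apply: (big_ind P P0 PD) => p _; rewrite -path_scaleE.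
apply: (PM); first exact: Pc.
case: p => [[v s] ws]; elim: s v ws => [|a s IHs] v ws.
  have -> : exist _ (v, [::]) ws = path_triv v by apply: val_inj.
  exact: Pv.
have ws' : walk (target a) s by have /andP[] := ws.
have -> : path_elt k (exist _ (v, a :: s) ws) =
    path_elt k (path_arrow a) * path_elt k (exist _ (target a, s) ws').
  rewrite path_eltM.
  case: path_compP => [r _ r1 r2 _|]; last by [].
  congr (path_elt k _); apply: path_eq; rewrite ?r1 ?r2 //=.
  by have /andP[/eqP] := ws.
by apply: PM; [exact: Pa | exact: IHs].
Qed.

(** A path goes to the product of its arrows, preceded by the idempotent of its start so that
    trivial paths have the right image. Orthogonality of the idempotents kills the products of paths
    that do not compose. *)
Lemma path_lift (M : nzRingType) (kappa : {rmorphism k -> M})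
    (e : vertex Q -> M) (f : arrow Q -> M) :
  (forall c x, GRing.comm (kappa c) x) ->
  (forall v w, e v * e w = e v *+ (v == w)) -> \sum_v e v = 1 ->
  (forall a, e (source a) * f a = f a) -> (forall a, f a * e (target a) = f a) ->
  exists g : {rmorphism KQ -> M},
    [/\ forall v, g (path_elt k (path_triv v)) = e v,
        forall a, g (path_elt k (path_arrow a)) = f a &
        forall c, g (scalar c) = kappa c].
Proof.
move=> kC ee e1 ef fe.
pose h (p : qpath Q) := e (path_src p) * \prod_(a <- path_seq p) f a.
have gZ c (x : KQ) : monalg.mmap kappa h (c *: x) = kappa c * monalg.mmap kappa h x.
  rewrite (monalg.mmapEw (monalg.msuppZ_le c x)) /= monalg.mmapE mulr_sumr.
  by apply: eq_bigr => p _; rewrite monalg.mcoeffZ rmorphM mulrA.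
have gE p : monalg.mmap kappa h (path_elt k p) = h p.
  by rewrite path_elt.unlock monalg.mmapU [X in X * _](rmorph1 kappa) mul1r.
have htriv v : h (path_triv v) = e v by rewrite /h big_nil mulr1.
have h_tgt p : h p * e (path_tgt p) = h p.
  rewrite /h /path_tgt; case: p => [[v s] ws]; rewrite /path_src /path_seq /=.
  elim: s v ws => [|a s IHs] v /=; first by rewrite big_nil !mulr1 ee eqxx.
  case/andP => /eqP <- ws.
  by rewrite big_cons -(fe a) -!mulrA [e (target a) * (_ * _)]mulrA IHs.
have hM p q : h p * h q = oapp h 0 (path_comp p q).
  case: path_compP => [r pq rp r_seq _ | /eqP/negPf pq] /=.
    rewrite {2}/h mulrA -pq h_tgt.
    by rewrite /h rp r_seq big_cat /= mulrA.
  rewrite -h_tgt -mulrA {2}/h [e _ * (_ * _)]mulrA ee pq.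
  by rewrite mulr0n mul0r mulr0.
have gM : monoid_morphism (monalg.mmap kappa h : KQ -> M).
  split=> [|x y].
    rewrite -[1]/(path_one k Q) raddf_sum -e1.
    by apply: eq_bigr => v _; rewrite /= gE.
  rewrite -[x * y]/(path_mul x y) path_mul.unlock raddf_sum /= mulr_suml.
  apply: eq_bigr => p _; rewrite raddf_sum mulr_sumr; apply: eq_bigr => q _ /=.
  rewrite gZ rmorphM -[LHS]mulrA -[RHS](mulrA (kappa _)); congr (_ * _).
  rewrite (mulrA (h p)) -(kC _ (h p)) -mulrA; congr (_ * _).
  rewrite hM /opath_elt; case: path_comp => [r|] /=; first exact: gE.
  exact: raddf0.
have gB : zmod_morphism (monalg.mmap kappa h : KQ -> M).
  by move=> x y; apply: raddfB.
pose gb := GRing.isZmodMorphism.Build _ _ _ gB.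
pose gm := GRing.isMonoidMorphism.Build _ _ _ gM.
pose G : {rmorphism KQ -> M} := HB.pack (monalg.mmap kappa h : KQ -> M) gb gm.
exists G; split=> [v|a|c].
- by rewrite [LHS]gE.
- by rewrite [LHS]gE /h big_cons big_nil mulr1 ef.
- by rewrite [LHS]gZ -[1]/(1 : KQ) [X in _ * X](rmorph1 G) mulr1.
Qed.

End PathAlgebraTheory.

(** * The multiplicative preprojective algebra by generators and relations *)

Section PreprojectiveTheory.
Variables (k : comNzRingType) (Q : quiver) (le : rel (arrow (double_quiver Q))).
Local Notation DQ := (double_quiver Q).
Local Notation Lam := (Lambda1 k le).
Implicit Types a b : arrow DQ.

Definition lam_in (x : path_alg k DQ) : Lam := qproj _ (loc_in (@loop_unit k Q) x).
HB.instance Definition _ := GRing.RMorphism.copy lam_in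
  (qproj (fun x : loc_path_alg k Q => x = rho k le - 1) \o loc_in (@loop_unit k Q)).

Definition lam_idem (v : vertex Q) : Lam := lam_in (path_elt k (@path_triv DQ v)).
Definition lam_arrow a : Lam := lam_in (darrow k a).
Definition lam_inv a : Lam := qproj _ (loc_inv (@loop_unit k Q) a).

Lemma lam_in_scalar c : lam_in (scalar c) = scalar c.
Proof. by rewrite /lam_in loc_in_scalar qproj_scalar. Qed.

Lemma lam_idemM v w : lam_idem v * lam_idem w = lam_idem v *+ (v == w).
Proof.
rewrite -rmorphM /= path_eltM path_comp_trivl -[path_src _]/w.
by case: eqP => [-> //|_]; rewrite mulr0n [LHS]raddf0.
Qed.

Lemma lam_idem_sum : \sum_v lam_idem v = 1.
Proof. by rewrite -(rmorph1 lam_in) -[1]/(path_one _ _) /path_one raddf_sum. Qed.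

Lemma lam_idem_arrow v a : lam_idem v * lam_arrow a = lam_arrow a *+ (v == source a).
Proof.
rewrite -rmorphM /= path_eltM path_comp_trivl -[path_src _]/(source a).
by case: eqP => // _; rewrite mulr0n [LHS]raddf0.
Qed.

Lemma lam_arrow_idem v a : lam_arrow a * lam_idem v = lam_arrow a *+ (v == target a).
Proof.
rewrite -rmorphM /= path_eltM path_comp_trivr -[path_tgt _]/(target a).
by case: eqP => // _; rewrite mulr0n [LHS]raddf0.
Qed.

Lemma lam_loop a : 1 + lam_arrow a * lam_arrow (star a) = lam_in (loop_unit k a).
Proof. by rewrite /loop_unit rmorphD rmorph1 rmorphM. Qed.

Lemma lam_mulrV a : (1 + lam_arrow a * lam_arrow (star a)) * lam_inv a = 1.
Proof.
by rewrite lam_loop -[LHS](rmorphM (qproj _)) loc_mulrV rmorph1.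
Qed.

Lemma lam_mulVr a : lam_inv a * (1 + lam_arrow a * lam_arrow (star a)) = 1.
Proof.
by rewrite lam_loop -[LHS](rmorphM (qproj _)) loc_mulVr rmorph1.
Qed.

Definition lam_factor a : Lam :=
  match a with
  | inl _ => 1 + lam_arrow a * lam_arrow (star a)
  | inr _ => lam_inv a
  end.

Lemma lam_prod : \prod_(a <- sort le (enum (arrow DQ))) lam_factor a = 1.
Proof.
have -> : \prod_(a <- sort le (enum (arrow DQ))) lam_factor a = qproj _ (rho k le).
  rewrite /rho rmorph_prod; apply: eq_bigr => -[] b _ //.
  exact: lam_loop.
transitivity (qproj (fun x : loc_path_alg k Q => x = rho k le - 1) 1).
  apply/qproj_eq; rewrite -[X in ideal_spec _ X]mulr1 -[X in X * 1]mul1r.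
  exact: IdealM.
exact: rmorph1.
Qed.

Lemma lam_ind (P : Lam -> Prop) :
  (forall x y, P x -> P y -> P (x + y)) -> (forall x y, P x -> P y -> P (x * y)) ->
  (forall c, P (scalar c)) -> (forall v, P (lam_idem v)) ->
  (forall a, P (lam_arrow a)) -> (forall a, P (lam_inv a)) -> forall x, P x.
Proof.
move=> PD PM Pc Pv Pa Pw.
elim/quot_ind; elim/loc_ind => [x y|x y|x|a].
- by rewrite rmorphD; apply: PD.
- by rewrite rmorphM; apply: PM.
- elim/path_ind: x => [x y|x y|c|v|a].
  + by rewrite !rmorphD; apply: PD.
  + by rewrite !rmorphM; apply: PM.
  + by rewrite loc_in_scalar qproj_scalar; apply: Pc.
  + exact: Pv.
  + exact: Pa.
- exact: Pw.
Qed.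

(** The universal properties of the path algebra, the localization and the quotient are applied in
    turn. *)
Lemma lam_lift (M : nzRingType) (kappa : {rmorphism k -> M})
    (e : vertex Q -> M) (f w : arrow DQ -> M) :
  (forall c x, GRing.comm (kappa c) x) ->
  (forall v w, e v * e w = e v *+ (v == w)) -> \sum_v e v = 1 ->
  (forall a, e (source a) * f a = f a) -> (forall a, f a * e (target a) = f a) ->
  (forall a, (1 + f a * f (star a)) * w a = 1) ->
  (forall a, w a * (1 + f a * f (star a)) = 1) ->
  \prod_(a <- sort le (enum (arrow DQ)))
    (match a with inl _ => 1 + f a * f (star a) | inr _ => w a end) = 1 ->
  exists g : {rmorphism Lam -> M},
    [/\ forall v, g (lam_idem v) = e v, forall a, g (lam_arrow a) = f a,
        forall a, g (lam_inv a) = w a & forall c, g (scalar c) = kappa c].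
Proof.
move=> kC ee e1 ef fe fw wf prod1.
have [g [ge gf gc]] := @path_lift k DQ M kappa e f kC ee e1 ef fe.
have gu a : g (loop_unit k a) = 1 + f a * f (star a).
  by rewrite /loop_unit rmorphD rmorph1 rmorphM /= !gf.
have [||h [hin hinv]] := @loc_lift k _ _ (@loop_unit k Q) M kappa g w kC gc.
- by move=> a; rewrite gu fw.
- by move=> a; rewrite gu wf.
have [|q qE] := @quot_lift k _ (fun x : loc_path_alg k Q => x = rho k le - 1) M h.
  move=> _ ->; rewrite rmorphB rmorph1 /rho rmorph_prod -[X in _ - X]prod1.
  apply/eqP; rewrite subr_eq0; apply/eqP/eq_bigr => -[] b _ /=.
    by rewrite hin gu.
  by rewrite hinv.
exists q; split=> [v|a|a|c].
- by rewrite [LHS]qE hin ge.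
- by rewrite [LHS]qE hin gf.
- by rewrite [LHS]qE hinv.
- by rewrite -lam_in_scalar [LHS]qE hin gc.
Qed.

End PreprojectiveTheory.

(** * Relations in the multiplicative preprojective algebra of a cycle *)

Section CyclicArrows.
Variables (n : nat) (o : 'I_n.+1 -> bool).
Local Notation DQ := (double_quiver (An_tilde o)).

(** The arrow of the double that leads from [i] to its successor: the original arrow or its reverse,
    as [o] dictates. *)
Definition up i : arrow DQ := if o i then inl i else inr i.
Definition dn i : arrow DQ := if o i then inr i else inl i.

Lemma star_up i : star (up i) = dn i.
Proof. by rewrite /up /dn; case: (o i). Qed.
Lemma star_dn i : star (dn i) = up i.
Proof. by rewrite /up /dn; case: (o i). Qed.
Lemma source_up i : source (up i) = i.
Proof. by rewrite /up; case: ifP => /= ->. Qed.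
Lemma target_up i : target (up i) = ordS i.
Proof. by rewrite /up; case: ifP => /= ->. Qed.
Lemma source_dn i : source (dn i) = ordS i.
Proof. by rewrite /dn; case: ifP => /= ->. Qed.
Lemma target_dn i : target (dn i) = i.
Proof. by rewrite /dn; case: ifP => /= ->. Qed.

Lemma up_neq_dn i j : up i != dn j.
Proof.
rewrite /up /dn; apply/eqP; case: ifP => oi; case: ifP => oj // [eij].
  by rewrite eij oj in oi.
by rewrite eij oj in oi.
Qed.

Lemma arrowP (P : arrow DQ -> Prop) :
  (forall i, P (up i)) -> (forall i, P (dn i)) -> forall a, P a.
Proof.
move=> Pu Pd [] i; have := Pu i; have := Pd i; rewrite /up /dn.
  by case: ifP.
by case: ifP.
Qed.

End CyclicArrows.

(** * Vertex relations and twisted arrows in an arbitrary ring *)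

Section CyclicRing.
Variables (n : nat) (o : 'I_n.+1 -> bool).
Local Notation DQ := (double_quiver (An_tilde o)).
Variables (le : rel (arrow DQ)) (R : pzRingType).
Variables (e : 'I_n.+1 -> R) (f w : arrow DQ -> R).
Hypothesis ee : forall v v', e v * e v' = e v *+ (v == v').
Hypothesis ef : forall v a, e v * f a = f a *+ (v == source a).
Hypothesis fe : forall v a, f a * e v = f a *+ (v == target a).
Hypothesis fw : forall a, (1 + f a * f (star a)) * w a = 1.
Hypothesis wf : forall a, w a * (1 + f a * f (star a)) = 1.

Definition factor (a : arrow DQ) : R :=
  match a with inl _ => 1 + f a * f (star a) | inr _ => w a end.

Let target_star (a : arrow DQ) : target (star a) = source a.
Proof. by case: a. Qed.

Let e_loop v a : GRing.comm (e v) (1 + f a * f (star a)).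
Proof.
apply: commrD; first exact: commr1.
by rewrite /GRing.comm mulrA ef -mulrA fe target_star mulrnAl mulrnAr.
Qed.

Let e_w v a : GRing.comm (e v) (w a).
Proof.
rewrite /GRing.comm -[LHS]mul1r -(wf a) -!mulrA; congr (_ * _).
by rewrite mulrA -e_loop -mulrA fw mulr1.
Qed.

Let e_factor v a : GRing.comm (e v) (factor a).
Proof. by case: a => b; [apply: e_loop | apply: e_w]. Qed.

(** The loop [f a * f (star a)] lives in the corner of [source a]; away from it the loop factor and
    its inverse act as 1. *)
Let e_factor1 (v : 'I_n.+1) (a : arrow DQ) : source a != v -> e v * factor a = e v.
Proof.
rewrite eq_sym => /negPf va; have loop1 : e v * (1 + f a * f (star a)) = e v.
  by rewrite mulrDr mulr1 mulrA ef va mulr0n mul0r addr0.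
rewrite /factor; case: a va loop1 => // b _ loop1.
by rewrite -{1}loop1 -mulrA fw mulr1.
Qed.

(** Exactly [up] of [j + 1] and [dn] of [j] start at the vertex [j + 1], and [le] decides which
    comes first. This precedes the assumption of the relation because the matrix representation
    verifies the relation with it. *)
Lemma vertex_prod j :
  let p := \prod_(a <- sort le (enum (arrow DQ))) factor a in
  e (ordS j) * p = e (ordS j) * (factor (up o (ordS j)) * factor (dn o j)) \/
  e (ordS j) * p = e (ordS j) * (factor (dn o j) * factor (up o (ordS j))).
Proof.
apply: mul_prod_two; rewrite ?sort_uniq ?enum_uniq ?mem_sort ?mem_enum ?up_neq_dn //.
elim/arrowP => i nu nd; apply: e_factor1; rewrite ?source_up ?source_dn.
  by apply: contra nu => /eqP ->.
by apply: contra nd => /eqP/ordS_inj ->.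
Qed.

Hypothesis prod1 : \prod_(a <- sort le (enum (arrow DQ))) factor a = 1.

(* The twisted downward arrow, for which [1 + up * low] is the factor of [rho]
   at [up] whatever the orientation. *)
Definition low i : R := if o i then f (dn o i) else - (f (dn o i) * w (up o i)).
(** If [o i] is false, [1 + f (up o i) * low i] is [w (up o i)], whose inverse is the untwisted loop
    factor. *)
Definition loop_inv i : R :=
  if o i then w (up o i) else 1 + f (up o i) * f (dn o i).

Let fw_up i : (1 + f (up o i) * f (dn o i)) * w (up o i) = 1.
Proof. by rewrite -star_up fw. Qed.
Let wf_up i : w (up o i) * (1 + f (up o i) * f (dn o i)) = 1.
Proof. by rewrite -star_up wf. Qed.

Let fw_dn i : (1 + f (dn o i) * f (up o i)) * w (dn o i) = 1.
Proof. by rewrite -star_dn fw. Qed.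
Let wf_dn i : w (dn o i) * (1 + f (dn o i) * f (up o i)) = 1.
Proof. by rewrite -star_dn wf. Qed.

Let factor_upE i :
  factor (up o i) = if o i then 1 + f (up o i) * f (dn o i) else w (up o i).
Proof. by rewrite -star_up /factor /up; case: (o i). Qed.
Let factor_dnE i :
  factor (dn o i) = if o i then w (dn o i) else 1 + f (dn o i) * f (up o i).
Proof. by rewrite -star_dn /factor /dn; case: (o i). Qed.

Let factor_up i : factor (up o i) = 1 + f (up o i) * low i.
Proof.
rewrite factor_upE /low; case: ifP => // _.
apply/esym/eqP; rewrite mulrN subr_eq mulrA -[X in X + _]mul1r -mulrDl.
by rewrite fw_up.
Qed.

Lemma up_lowV i : (1 + f (up o i) * low i) * loop_inv i = 1.
Proof. by rewrite -factor_up factor_upE /loop_inv; case: ifP. Qed.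

Lemma up_lowVr i : loop_inv i * (1 + f (up o i) * low i) = 1.
Proof. by rewrite -factor_up factor_upE /loop_inv; case: ifP. Qed.

Let dn_loop i : (1 + f (dn o i) * f (up o i)) * f (dn o i) =
  f (dn o i) * (1 + f (up o i) * f (dn o i)).
Proof. by rewrite mulrDr mulrDl mulr1 mul1r mulrA. Qed.

(** In the twisted case, an inverse of [1 + a * b] is turned into one of [1 + b * a]: if
    [v * (1 + a * b) = 1], then [(1 - b * v * a) * (1 + b * a) = 1]. *)
Let low_upV i : (1 + low i * f (up o i)) * factor (dn o i) = 1.
Proof.
rewrite factor_dnE /low; case: ifP => // _.
rewrite mulrDl mul1r !mulNr -mulrA.
have -> : f (up o i) * (1 + f (dn o i) * f (up o i)) =
    (1 + f (up o i) * f (dn o i)) * f (up o i).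
  by rewrite mulrDr mulrDl mulr1 mul1r mulrA.
by rewrite [_ * (_ * f (up o i))]mulrA -[f _ * w _ * (1 + _)]mulrA wf_up mulr1 addrK.
Qed.

Let low_upVr i : factor (dn o i) * (1 + low i * f (up o i)) = 1.
Proof.
rewrite factor_dnE /low; case: ifP => // _.
rewrite mulrDr mulr1 mulNr mulrN !mulrA.
by rewrite dn_loop -[f _ * _ * w _]mulrA fw_up mulr1 addrK.
Qed.

Lemma idem_up v i : e v * f (up o i) = f (up o i) *+ (v == i).
Proof. by rewrite ef source_up. Qed.
Lemma up_idem v i : f (up o i) * e v = f (up o i) *+ (v == ordS i).
Proof. by rewrite fe target_up. Qed.
Lemma idem_low v i : e v * low i = low i *+ (v == ordS i).
Proof.
rewrite /low; case: ifP => _; first by rewrite ef source_dn.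
by rewrite mulrN mulrA ef source_dn mulrnAl mulNrn.
Qed.
Lemma low_idem v i : low i * e v = low i *+ (v == i).
Proof.
rewrite /low; case: ifP => _; first by rewrite fe target_dn.
by rewrite mulNr -mulrA -e_w mulrA fe target_dn mulrnAl mulNrn.
Qed.

(** At the vertex [j + 1] the relation says that the up factor and the down factor multiply to 1.
    The former is 1 plus the left side, the latter the inverse of 1 plus the right side, so both
    sides agree whatever the order of the factors. *)
Lemma up_low_exchange j : f (up o (ordS j)) * low (ordS j) = low j * f (up o j).
Proof.
have eUD i : e i * (f (up o i) * low i) = f (up o i) * low i.
  by rewrite mulrA idem_up eqxx.
have eDU i : e (ordS i) * (low i * f (up o i)) = low i * f (up o i).
  by rewrite mulrA idem_low eqxx.
have e_low i v : GRing.comm (e v) (1 + low i * f (up o i)).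
  apply: commrD; first exact: commr1.
  by rewrite /GRing.comm mulrA idem_low -mulrA up_idem mulrnAl mulrnAr.
suff: e (ordS j) * factor (up o (ordS j)) = e (ordS j) * (1 + low j * f (up o j)).
  by rewrite factor_up !mulrDr eUD eDU => /addrI.
have := vertex_prod j; rewrite /= prod1 mulr1 => -[] eF.
  by rewrite [in RHS]eF -!mulrA low_upVr mulr1.
(* With the down factor first, its inverse has to act from the left, so the idempotent is moved
   across. *)
rewrite [RHS]e_low [in RHS]eF [RHS]mulrA -e_low -mulrA [X in _ = _ * X]mulrA.
by rewrite low_upV mul1r.
Qed.

Hypothesis e1 : \sum_i e i = 1.
Definition sum_up := \sum_i f (up o i).
Definition sum_low := \sum_i low i.
(** The factor [e i] keeps the corner of [loop_inv i] at the vertex [i], so the sum inverts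
    [1 + sum_up * sum_low] corner by corner. *)
Definition sum_inv := \sum_i e i * loop_inv i.

Lemma idem_sum_up i : e i * sum_up = f (up o i).
Proof.
rewrite mulr_sumr (bigD1 i) //= idem_up eqxx mulr1n big1 ?addr0 // => j ne.
by rewrite idem_up eq_sym (negPf ne).
Qed.

Lemma sum_up_idem i : sum_up * e (ordS i) = f (up o i).
Proof.
rewrite mulr_suml (bigD1 i) //= up_idem eqxx mulr1n big1 ?addr0 // => j ne.
by rewrite up_idem (inj_eq (@ordS_inj _)) eq_sym (negPf ne).
Qed.

Lemma idem_sum_low i : e (ordS i) * sum_low = low i.
Proof.
rewrite mulr_sumr (bigD1 i) //= idem_low eqxx mulr1n big1 ?addr0 // => j ne.
by rewrite idem_low (inj_eq (@ordS_inj _)) eq_sym (negPf ne).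
Qed.

Lemma sum_low_idem i : sum_low * e i = low i.
Proof.
rewrite mulr_suml (bigD1 i) //= low_idem eqxx mulr1n big1 ?addr0 // => j ne.
by rewrite low_idem eq_sym (negPf ne).
Qed.

Lemma idem_sum_upE i : e i * sum_up = sum_up * e (ordS i).
Proof. by rewrite idem_sum_up sum_up_idem. Qed.

Lemma idem_sum_lowE i : e (ordS i) * sum_low = sum_low * e i.
Proof. by rewrite idem_sum_low sum_low_idem. Qed.

Lemma sum_up_lowE : sum_up * sum_low = \sum_i f (up o i) * low i.
Proof.
rewrite mulr_sumr; apply: eq_bigr => i _.
have {1}-> : low i = e (ordS i) * low i by rewrite idem_low eqxx.
by rewrite mulrA sum_up_idem.
Qed.

Lemma sum_low_upE : sum_low * sum_up = \sum_i low i * f (up o i).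
Proof.
rewrite mulr_sumr; apply: eq_bigr => i _.
have {1}-> : f (up o i) = e i * f (up o i) by rewrite idem_up eqxx.
by rewrite mulrA sum_low_idem.
Qed.

Lemma sum_up_lowC : GRing.comm sum_up sum_low.
Proof.
rewrite /GRing.comm sum_up_lowE sum_low_upE (reindex_inj (@ordS_inj _)).
by apply: eq_bigr => i _; rewrite /= up_low_exchange.
Qed.

Let e_inv i : GRing.comm (e i) (loop_inv i).
Proof.
rewrite /loop_inv; case: ifP => _; first exact: e_w.
by rewrite -star_up; apply: e_loop.
Qed.

Lemma sum_invP : sum_inv * (1 + sum_up * sum_low) = 1.
Proof.
rewrite mulr_suml -[RHS]e1; apply: eq_bigr => i _.
have -> : e i * loop_inv i * (1 + sum_up * sum_low) =
    e i * loop_inv i * (1 + f (up o i) * low i).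
  rewrite e_inv -!mulrA; congr (_ * _); rewrite !mulrDr; congr (_ + _).
  rewrite sum_up_lowE mulr_sumr (bigD1 i) //= big1 ?addr0 // => j ne.
  by rewrite mulrA idem_up eq_sym (negPf ne) mulr0n mul0r.
by rewrite -mulrA up_lowVr mulr1.
Qed.

Lemma sum_invP' : (1 + sum_up * sum_low) * sum_inv = 1.
Proof.
rewrite mulr_sumr -[RHS]e1; apply: eq_bigr => i _.
have -> : (1 + sum_up * sum_low) * (e i * loop_inv i) =
    (1 + f (up o i) * low i) * (e i * loop_inv i).
  rewrite !mulrA; congr (_ * _); rewrite !mulrDl; congr (_ + _).
  rewrite sum_up_lowE mulr_suml (bigD1 i) //= big1 ?addr0 // => j ne.
  by rewrite -mulrA low_idem eq_sym (negPf ne) mulr0n mulr0.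
by rewrite e_inv mulrA up_lowV mul1r.
Qed.

(** Outside the corner of [i] the loop inverse is the identity. This puts it in the subring
    generated by the idempotents and [sum_inv]. *)
Lemma loop_invE i : loop_inv i = 1 - e i + e i * sum_inv.
Proof.
have -> : e i * sum_inv = e i * loop_inv i.
  rewrite mulr_sumr (bigD1 i) //= mulrA ee eqxx mulr1n big1 ?addr0 // => j ne.
  by rewrite mulrA ee eq_sym (negPf ne) mulr0n mul0r.
have eh : (1 - e i) * loop_inv i = 1 - e i.
  have step : (1 - e i) * (1 + f (up o i) * low i) = 1 - e i.
    rewrite mulrBl mul1r mulrDr mulr1 mulrA idem_up eqxx mulr1n.
    by rewrite opprD addrACA subrr addr0.
  by rewrite -{1}step -mulrA up_lowV mulr1.
by rewrite -[X in X + _]eh -mulrDl subrK mul1r.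
Qed.

(** Cutting the sums by idempotents recovers the upward arrows, [low i] and [loop_inv i];
    multiplying by a loop factor undoes the twist of the downward arrows. *)
Lemma cyclic_ring_gen (P : R -> Prop) :
  (forall x y, P x -> P y -> P (x + y)) -> (forall x y, P x -> P y -> P (x * y)) ->
  P (-1) -> (forall i, P (e i)) -> P sum_up -> P sum_low -> P sum_inv ->
  forall a, P (f a) /\ P (w a).
Proof.
move=> PD PM PN1 Pe Pu Pl Pi.
have PN x : P x -> P (- x) by move=> Px; rewrite -mulN1r; apply: PM.
have P1 : P 1 by rewrite -[1]opprK; apply: PN.
have Pup i : P (f (up o i)) by rewrite -(idem_sum_up i); apply: PM.
have Plow i : P (low i) by rewrite -(idem_sum_low i); apply: PM.
have Pinv i : P (loop_inv i).
  by rewrite loop_invE; exact: PD (PD _ _ P1 (PN _ (Pe i))) (PM _ _ (Pe i) Pi).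
have Pdn i : P (f (dn o i)).
  have := Plow i; have := Pinv i; rewrite /low /loop_inv; case: ifP => // _ Pi' Pl'.
  have -> : f (dn o i) =
      - (- (f (dn o i) * w (up o i)) * (1 + f (up o i) * f (dn o i))).
    by rewrite mulNr opprK -mulrA wf_up mulr1.
  by apply/PN/PM.
have Pw_up i : P (w (up o i)).
  case oi: (o i).
    by have := Pinv i; rewrite /loop_inv oi.
  by have := factor_up i; rewrite factor_upE oi => ->; apply: PD => //; apply: PM.
elim/arrowP => i; split=> //.
(* Again the inverse of [1 + b * a] is expressed through that of [1 + a * b]. *)
have -> : w (dn o i) = 1 - f (dn o i) * w (up o i) * f (up o i).
  rewrite -[LHS]mulr1 -[RHS]mul1r -[X in _ = X * _](wf_dn i) -mulrA; congr (_ * _).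
  rewrite mulrBr mulr1 !mulrA dn_loop -[f _ * _ * w _]mulrA fw_up mulr1.
  by rewrite addrK.
exact: PD P1 (PN _ (PM _ _ (PM _ _ (Pdn i) (Pw_up i)) (Pup i))).
Qed.

End CyclicRing.

Lemma mul_delta_col (R : pzRingType) (m p : nat) i j (v : 'cV[R]_p) l :
  ((delta_mx i j : 'M_(m, p)) *m v) l 0 = v j 0 *+ (l == i).
Proof.
rewrite mxE (bigD1 j) //= mxE eqxx andbT big1 ?addr0 => [|j' ne].
  by case: eqP => _; rewrite ?mul1r // mul0r.
by rewrite mxE (negPf ne) andbF mul0r.
Qed.

(** * The matrix representation *)

Section MatrixRepresentation.
Variables (F : fieldType) (n : nat) (o : 'I_n.+1 -> bool) (x y : F).
Local Notation DQ := (double_quiver (An_tilde o)).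
Local Notation M := 'M[F]_n.+1.
Let t : F := 1 + x * y.
Hypothesis t_neq0 : t != 0.

Definition mx_idem (i : 'I_n.+1) : M := delta_mx i i.
(* The coefficients are such that [low i] is mapped to [y] in position
   [(ordS i, i)] for either orientation, see [mx_low]. *)
Definition mx_coef (a : arrow DQ) : F :=
  match a with
  | inl i => if o i then x else - (y / t)
  | inr i => if o i then y else x
  end.
Definition mx_arrow a : M := mx_coef a *: delta_mx (source a) (target a).
Definition mx_weight a : F := mx_coef a * mx_coef (star a).
(** The loop factor is diagonal, with entry [1 + mx_weight a] at [source a] and 1 elsewhere; only
    that entry is inverted. *)
Definition mx_inv a : M :=
  1 + ((1 + mx_weight a)^-1 - 1) *: mx_idem (source a).

Let weightE a :
  1 + mx_weight a = match a with inl i | inr i => if o i then t else t^-1 end.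
Proof.
have wE : 1 - x * (y / t) = t^-1.
  by rewrite -{1}(divff t_neq0) mulrA -mulrBl addrK mul1r.
rewrite /mx_weight; case: a => i /=; case: (o i) => //.
- by rewrite mulNr mulrC wE.
- by rewrite [y * x]mulrC.
- by rewrite mulrN wE.
Qed.

Let weight_unit a : 1 + mx_weight a != 0.
Proof. by rewrite weightE; case: a => i; case: (o i); rewrite ?invr_eq0. Qed.

Lemma mx_idemM i j : mx_idem i * mx_idem j = mx_idem i *+ (i == j).
Proof.
rewrite /mx_idem; case: eqP => [->|/eqP ne]; first exact: mul_delta_mx.
exact: mul_delta_mx_0.
Qed.

Lemma mx_idem_arrow v a : mx_idem v * mx_arrow a = mx_arrow a *+ (v == source a).
Proof.
rewrite /mx_arrow -scalerAr; case: eqP => [->|/eqP ne].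
  by rewrite [_ * _]mul_delta_mx.
by rewrite [_ * _]mul_delta_mx_0 // scaler0.
Qed.

Lemma mx_arrow_idem v a : mx_arrow a * mx_idem v = mx_arrow a *+ (v == target a).
Proof.
rewrite /mx_arrow -scalerAl eq_sym; case: eqP => [->|/eqP ne].
  by rewrite [_ * _]mul_delta_mx.
by rewrite [_ * _]mul_delta_mx_0 // scaler0.
Qed.

Let mx_loop a :
  1 + mx_arrow a * mx_arrow (star a) = 1 + mx_weight a *: mx_idem (source a).
Proof.
rewrite /mx_arrow -scalerAl -scalerAr scalerA; congr (1 + _ *: _).
by case: a => i; exact: mul_delta_mx.
Qed.

Let mx_unipM (c c' : F) i : (1 + c) * (1 + c') = 1 ->
  (1 + c *: mx_idem i) * (1 + c' *: mx_idem i) = 1.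
Proof.
move=> cc'; rewrite mulrDl mul1r -scalerAl mulrDr mulr1 -scalerAr mx_idemM eqxx mulr1n.
rewrite scalerDr scalerA -addrA -!scalerDl.
have -> : c' + (c + c * c') = 0.
  by apply: (addrI 1); rewrite addr0 -[RHS]cc' mulrDl mul1r mulrDr mulr1 !addrA.
by rewrite scale0r addr0.
Qed.

Lemma mx_mulrV a : (1 + mx_arrow a * mx_arrow (star a)) * mx_inv a = 1.
Proof. by rewrite mx_loop mx_unipM // [1 + (_ - 1)]addrC subrK divff. Qed.

Lemma mx_mulVr a : mx_inv a * (1 + mx_arrow a * mx_arrow (star a)) = 1.
Proof. by rewrite mx_loop mx_unipM // [1 + (_ - 1)]addrC subrK mulVf. Qed.

Let mx_factor_up i : factor mx_arrow mx_inv (up o i) = 1 + (x * y) *: mx_idem i.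
Proof.
have := weightE (up o i); rewrite /factor /up; case: ifP => oi we.
  rewrite mx_loop /= oi; congr (1 + _ *: _).
  by apply: (addrI 1); rewrite we oi.
by rewrite /mx_inv we oi invrK /= oi; congr (1 + _ *: _); rewrite addrC addKr.
Qed.

Let mx_factor_dn i :
  factor mx_arrow mx_inv (dn o i) = 1 + (t^-1 - 1) *: mx_idem (ordS i).
Proof.
have := weightE (dn o i); rewrite /factor /dn; case: ifP => oi we.
  by rewrite /mx_inv we oi /= oi.
rewrite mx_loop /= oi; congr (1 + _ *: _).
by apply: (addrI 1); rewrite we oi addrC subrK.
Qed.

Let mx_idem_sum : \sum_i mx_idem i = 1.
Proof. by rewrite -[RHS]/(1%:M) mx1_sum_delta. Qed.

(** At each vertex the two relevant factors have diagonal entries [t] and [t^-1], which cancel in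
    either order. *)
Lemma mx_prod (le : rel (arrow DQ)) :
  \prod_(a <- sort le (enum (arrow DQ))) factor mx_arrow mx_inv a = 1.
Proof.
rewrite -[LHS]mul1r -[X in X * _]mx_idem_sum mulr_suml -[RHS]mx_idem_sum.
rewrite [LHS](reindex_inj (@ordS_inj _)) [RHS](reindex_inj (@ordS_inj _)).
apply: eq_bigr => j _ /=.
have tt : (1 + x * y) * (1 + (t^-1 - 1)) = 1.
  by rewrite [1 + (_ - 1)]addrC subrK divff.
have := vertex_prod le mx_idem_arrow mx_arrow_idem mx_mulrV mx_mulVr j.
rewrite /= mx_factor_up mx_factor_dn => -[] ->.
  by rewrite mx_unipM // mulr1.
by rewrite mx_unipM ?mulr1 // mulrC.
Qed.

Lemma mx_up i : mx_arrow (up o i) = x *: delta_mx i (ordS i).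
Proof.
by rewrite /mx_arrow source_up target_up /up /mx_coef; case oi: (o i); rewrite oi.
Qed.

Lemma mx_low i : low mx_arrow mx_inv i = y *: delta_mx (ordS i) i.
Proof.
have f_dn : mx_arrow (dn o i) = mx_coef (dn o i) *: delta_mx (ordS i) i.
  by rewrite /mx_arrow source_dn target_dn.
rewrite /low f_dn /mx_inv weightE source_up /dn /up /mx_coef.
case oi: (o i); rewrite oi //.
(* [mx_inv (up o i)] multiplies column [i] by [t], which cancels the denominator in the coefficient
   of the downward arrow. *)
rewrite invrK -scalerAl mulrDr mulr1 -scalerAr [_ * mx_idem i]mul_delta_mx.
rewrite -[X in X + _]scale1r -scalerDl [1 + _]addrC subrK scalerA mulNr scaleNr.
by rewrite opprK divfK.
Qed.

Lemma matrix_representation (k : comNzRingType) (kappa : {rmorphism k -> F})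
    (le : rel (arrow DQ)) :
  exists phi : {rmorphism Lambda1 k le -> M},
    [/\ forall v, phi (lam_idem k le v) = mx_idem v,
        forall a, phi (lam_arrow k le a) = mx_arrow a,
        forall a, phi (lam_inv k le a) = mx_inv a &
        forall c, phi (scalar c) = (kappa c)%:M].
Proof.
apply: (@lam_lift _ _ _ _ (scalar_mx \o kappa : {rmorphism k -> M})).
- by move=> c A; apply/esym/scalar_mxC.
- exact: mx_idemM.
- exact: mx_idem_sum.
- by move=> a; rewrite mx_idem_arrow eqxx.
- by move=> a; rewrite mx_arrow_idem eqxx.
- exact: mx_mulrV.
- exact: mx_mulVr.
- exact: mx_prod.
Qed.

End MatrixRepresentation.

(** * The center for a cycle, given an embedding of [k[X, Y]] into a field *)

Section Lambda1Center.
Variables (k F : fieldType) (n : nat) (o : 'I_n.+1 -> bool).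
Variable le : rel (arrow (double_quiver (An_tilde o))).
Variable iota : {rmorphism mpoly 2 k -> F}.
Hypothesis iota_inj : injective iota.
Local Notation L := (Lambda1 k le).

Let x := iota 'X_0.
Let y := iota 'X_1.
Let e : 'I_n.+1 -> L := @lam_idem k _ le.
Let f := @lam_arrow k _ le.
Let w := @lam_inv k _ le.

Let ee : forall v v' : 'I_n.+1, e v * e v' = e v *+ (v == v').
Proof. exact: (@lam_idemM k _ le). Qed.
Let ef : forall (v : 'I_n.+1) a, e v * f a = f a *+ (v == source a).
Proof. exact: (@lam_idem_arrow k _ le). Qed.
Let fe : forall (v : 'I_n.+1) a, f a * e v = f a *+ (v == target a).
Proof. exact: (@lam_arrow_idem k _ le). Qed.
Let fw : forall a, (1 + f a * f (star a)) * w a = 1.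
Proof. exact: (@lam_mulrV k _ le). Qed.
Let wf : forall a, w a * (1 + f a * f (star a)) = 1.
Proof. exact: (@lam_mulVr k _ le). Qed.
Let e1 : \sum_i e i = 1.
Proof. exact: lam_idem_sum. Qed.

Let t_neq0 : 1 + x * y != 0.
Proof.
have -> : 1 + x * y = iota (1 + 'X_0 * 'X_1) by rewrite rmorphD rmorph1 rmorphM.
rewrite -(rmorph0 iota) (inj_eq iota_inj).
(* At the origin the polynomial [1 + 'X_0 * 'X_1] takes the value 1. *)
apply/eqP => /(congr1 (meval (fun _ => 0))).
rewrite rmorphD rmorph1 rmorphM /= mevalXU mul0r addr0 rmorph0.
by apply/eqP/oner_neq0.
Qed.

Theorem lambda1_center : alg_isomorphic (center_alg L) (center_model k n).
Proof.
pose kappa : {rmorphism k -> F} := iota \o @mpolyC 2 k.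
have [phi [phi_e phi_f phi_w phi_c]] := matrix_representation t_neq0 kappa le.
have phi_low i : phi (low f w i) = y *: delta_mx (ordS i) i.
  rewrite -(mx_low o t_neq0 i) /low; case: ifP => _; first by rewrite phi_f.
  by rewrite rmorphN rmorphM /= phi_f phi_w.
apply: (@cyclic_center k n L F iota iota_inj e (sum_up f) (sum_low f w)
  (sum_inv e f w) ee e1 _ _ _ _ _ _ phi).
- exact: (idem_sum_upE ef fe).
- exact: (idem_sum_lowE ef fe fw wf).
- exact: (sum_up_lowC ef fe fw wf (lam_prod k le)).
- exact: (sum_invP ef fe fw wf e1).
- exact: (sum_invP' ef fe fw wf e1).
- move=> P PD PM Pc Pe Pu Pd Pz.
  have PN1 : P (-1) by rewrite -(rmorphN1 (@scalar k L)); apply: Pc.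
  have Pfw := cyclic_ring_gen ee ef fw wf PD PM PN1 Pe Pu Pd Pz.
  by apply: lam_ind => // a; have [] := Pfw a.
- by move=> i v j; rewrite phi_e mul_delta_col eq_sym; case: eqP => [->|].
- move=> v j; rewrite rmorph_sum mulmx_suml summxE (bigD1 j) //= big1 => [|i ne].
    by rewrite phi_f mx_up -scalemxAl mxE mul_delta_col eqxx addr0.
  by rewrite phi_f mx_up -scalemxAl mxE mul_delta_col eq_sym (negPf ne) mulr0.
- move=> v j; rewrite rmorph_sum mulmx_suml summxE (bigD1 j) //= big1 => [|i ne].
    by rewrite phi_low -scalemxAl mxE mul_delta_col eqxx addr0.
  rewrite phi_low -scalemxAl mxE mul_delta_col (inj_eq (@ordS_inj _)) eq_sym.
  by rewrite (negPf ne) mulr0.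
- exact: phi_c.
Qed.

End Lambda1Center.

Theorem corollary6p7 (k : fieldType) (n : nat) (hn : (1 <= n)%N)
    (o : 'I_n.+1 -> bool)
    (le : rel (arrow (double_quiver (An_tilde o))))
    (le_refl : reflexive le) (le_anti : antisymmetric le)
    (le_trans : transitive le) (le_total : total le) :
  alg_isomorphic (center_alg (Lambda1 k le)) (center_model k n).
Proof.
(* The field of fractions of [k[X, Y]] is used, since the matrix entries may have the denominator
   [1 + x * y]. *)
apply: (@lambda1_center k {fraction (mpoly 2 k)} n o le (@FracField.tofrac (mpoly 2 k))).
by move=> p q /eqP; rewrite tofrac_eq => /eqP.
Qed.
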